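(* Assume $\Diamond$. Let $C=2^\omega$ be the Cantor space and let $G_0$ be a countable group of autohomeomorphisms of $C$ which acts freely on $C$ (i.e. $g(x)\neq x$ for all $x\in C$ and all $g\in G_0\setminus\{\mathrm{id}\}$). Let $\pi:C\times C^{\omega_1}\to C$ be the projection onto the first coordinate. Then there exist a space $X\subseteq C\times C^{\omega_1}$, a group $G\supseteq G_0$ (containing $G_0$ as a subgroup) and a continuous action $*:G\times X\to X$ such that: (i) $X$ is compact, has no isolated points, and $\pi\restriction X:X\to C$ is surjective; (ii) $X$ is hereditarily separable and has no non-trivial convergent sequences; (iii) the action $*$ is free, and $g(\pi(x))=\pi(g*x)$ for all $x\in X$ and $g\in G_0$; (iv) $Hom(X)\subseteq H(X,G)$; (v) $\{X\cap\pi^{-1}K: K\subseteq C \text{ non-empty clopen}\}$ is a $\pi$-base of $X$.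
   Context: $\Diamond$ is Jensen's diamond principle: there is a sequence $\langle A_\alpha:\alpha<\omega_1\rangle$ with $A_\alpha\subseteq\alpha$ such that for every $A\subseteq\omega_1$ the set $\{\alpha<\omega_1:A\cap\alpha=A_\alpha\}$ is stationary in $\omega_1$. Groups carry the discrete topology, so a continuous action is one in which each group element acts as a homeomorphism. $Hom(X)$ is the group of homeomorphisms of $X$ onto $X$. For a group $G$ acting on $X$, $f\in Hom(X)$ is locally in $G$ if for every $x\in X$ there are an open neighborhood $U$ of $x$ and $g\in G$ with $f(u)=g(u)$ (here $g*u$) for all $u\in U$; $H(X,G)$ is the set of all $f\in Hom(X)$ that are locally in $G$. A space is hereditarily separable if every subspace is separable. A convergent sequence is non-trivial if it is not eventually constant. A $\pi$-base of $X$ is a family of non-empty open sets such that every non-empty open subset of $X$ contains a member of the family. *)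

(* Defs.v *)
From HB Require Import structures.
From mathcomp Require Import all_boot all_order.
From mathcomp Require Import all_classical.
From mathcomp Require Import wochoice topology cantor.

Set Implicit Arguments.
Unset Strict Implicit.
Unset Printing Implicit Defensive.

Import Order.TTheory.
Local Open Scope classical_set_scope.

(* Characterizes omega_1 up to order isomorphism; an ordinal alpha < omega_1 is
   an element of W, and the set alpha is the initial segment below it. *)
Definition is_omega1 d (W : orderType d) :=
  [/\ well_order (fun a b : W => (a <= b)%O),
      ~ countable [set: W] &
      forall a : W, countable [set b : W | (b < a)%O]].

(* Closedness only constrains the limit elements: the last hypothesis fails at
   successors, and the first one discards the least element. *)
Definition club d (W : orderType d) (D : set W) :=
  (forall a : W, exists2 b, D b & (a < b)%O) /\
  (forall a : W, (exists b, (b < a)%O) ->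
    (forall b, (b < a)%O -> exists c, [/\ D c, (b < c)%O & (c < a)%O]) -> D a).

Definition stationary d (W : orderType d) (S : set W) :=
  forall D : set W, club D -> S `&` D !=set0.

Definition diamond d (W : orderType d) :=
  exists A : W -> set W,
    (forall a, A a `<=` [set b | (b < a)%O]) /\
    forall B : set W,
      stationary [set a | B `&` [set b | (b < a)%O] = A a].

Section Spaces.
Implicit Types T : topologicalType.

Definition Hom T : set (T -> T) :=
  [set f | exists g : T -> T,
     [/\ cancel f g, cancel g f, continuous f & continuous g]].

Definition homeo_group T (G0 : set (T -> T)) :=
  [/\ G0 `<=` @Hom T,
      G0 idfun,
      (forall f g, G0 f -> G0 g -> G0 (f \o g)) &
      (forall f, G0 f -> exists g, [/\ G0 g, cancel f g & cancel g f])].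

Definition acts_freely T (G0 : set (T -> T)) :=
  forall g, G0 g -> g <> idfun -> forall x, g x <> x.

Definition separable T := exists2 D : set T, countable D & dense D.

(* The coercion of a set Y to set_type Y carries the subspace topology. *)
Definition hereditarily_separable T := forall Y : set T, separable Y.

Definition eventually_constant (T : Type) (u : nat -> T) :=
  exists c : T, \forall n \near \oo, u n = c.

Definition no_nontrivial_convergent_sequences T :=
  forall u : nat -> T, (exists l : T, u @ \oo --> l) -> eventually_constant u.

Definition pi_base T (B : set (set T)) :=
  (forall U, B U -> open U /\ U !=set0) /\
  (forall O : set T, open O -> O !=set0 -> exists2 U, B U & U `<=` O).

(* The group is discrete, so joint continuity amounts to each element acting
   by a homeomorphism. *)
Definition continuous_action (G : groupType) T (act : G -> T -> T) :=
  [/\ forall x, act 1%g x = x,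
      forall g h x, act (g * h)%g x = act g (act h x) &
      forall g, @Hom T (act g)].

Definition free_action (G : groupType) T (act : G -> T -> T) :=
  forall g, g <> 1%g -> forall x, act g x <> x.

Definition locally_in (G : groupType) T (act : G -> T -> T) (f : T -> T) :=
  forall x, exists U : set T, exists g : G,
    [/\ open U, U x & forall u, U u -> f u = act g u].

Definition Hloc (G : groupType) T (act : G -> T -> T) : set (T -> T) :=
  [set f | @Hom T f /\ locally_in act f].

End Spaces.

(* The inclusion of the subgroup G0 in G, as an injective homomorphism; values
   of iota outside G0 are irrelevant. *)
Definition subgroup_embedding (T : Type) (G0 : set (T -> T)) (G : groupType)
    (iota : (T -> T) -> G) :=
  (forall g h, G0 g -> G0 h -> iota g = iota h -> g = h) /\
  (forall g h, G0 g -> G0 h -> iota (g \o h) = (iota g * iota h)%g).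

(* Main.v *)
Require Import Defs.
From HB Require Import structures.
From mathcomp Require Import all_boot all_order.
From mathcomp Require Import all_classical.
From mathcomp Require Import topology cantor.

Set Implicit Arguments.
Unset Strict Implicit.
Unset Printing Implicit Defensive.

Import Order.TTheory.
Local Open Scope classical_set_scope.

(** The space X is the limit of an inverse system of length omega_1 of
zero-dimensional compacta starting with the Cantor set. At stage a one G0-orbit
is split: a function f with values in {0,1}, continuous off a point p of X_a,
is chosen, and X_(a+1) is the closure of the graph of x |-> (f(g^-1 x))_(g in
G0), so that G0 acts on it by shifting coordinates. Only the coordinate g is
ambiguous at g p, because G0 acts freely. The group G is G0 itself.

Call a subset S of X_a attracted to z in X_b, for b >= a, if every neighbourhood
of z contains a whole fibre of X_b -> X_a over some point of S. Since f may be
taken constant on any prescribed sequence of small sets converging to p, each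
splitting can respect countably many such relations; limits respect them for
free.

Diamond guesses a relation Gamma on X_a. Its domain is respected from stage a
on, which gives hereditary separability: for a left-separated sequence (y_b),
guessed as {(y_b, y_b)}, the point y_a would be in the closure of the earlier
ones. If moreover (x, y) is, for each g in G0, a cluster point of the pairs of
Gamma off the graph of g, then y is split in such a way that the points u with (u, v) in
Gamma and f(v) = 0, and likewise with f(v) = 1, are attracted to every point
above x. If Gamma came from a homeomorphism h of X which is not locally in G0
(as pairs (d_n, h(d_n)), with (d_n) dense), or from a convergent sequence (as
pairs (u_m, u_n), m < n), this contradicts the continuity of h or the
convergence. *)

(** * Countable sets *)

Lemma countable_range T (A : set T) : countable A -> A !=set0 ->
  exists e : nat -> T, range e = A.
Proof.
move=> /countable_injP[f finj] [x0 Ax0].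
exists (fun n => if pselect (exists2 x, A x & f x = n) is left h
                 then s2val (cid2 h) else x0).
apply/seteqP; split=> [_ [n _ <-]|x Ax].
  by case: pselect => // h; case: cid2.
exists (f x) => //; case: pselect => [h|[]]; last by exists x.
by case: cid2 => y Ay fxy /=; apply: finj; rewrite ?inE.
Qed.

Lemma countable_setU T (A B : set T) :
  countable A -> countable B -> countable (A `|` B).
Proof.
move=> cA cB; rewrite -bigcup2E; apply: bigcup_countable => //.
by move=> [|[|n]] _ //=; exact: countable0.
Qed.

Lemma countable_image T U (f : T -> U) (A : set T) :
  countable A -> countable (f @` A).
Proof. exact: sub_countable (card_image_le _ _). Qed.

(** * The order omega_1: bounds, recursion and closure points *)

Section Omega1.
Variables (d : Order.disp_t) (W : orderType d).
Hypothesis W_omega1 : is_omega1 W.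
Implicit Types (a b c : W).

Definition below a : set W := [set b | (b < a)%O].
Definition upto a : set W := [set b | (b <= a)%O].

Lemma omega1_wf : well_founded (fun a b : W => (a < b)%O).
Proof.
case: W_omega1 => wo _ _ a; apply: contrapT => nAcc.
have [z [[zN zmin] _]] := wo [pred x | `[< ~ Acc (fun a b : W => (a < b)%O) x >]]
   (ex_intro _ a (asboolT nAcc)).
move/asboolP: zN; apply; constructor=> y yz; apply: contrapT => yN.
by have := zmin y (asboolT yN); rewrite leNgt yz.
Qed.

Lemma omega1_min (P : W -> Prop) : (exists a, P a) ->
  exists a, P a /\ forall b, P b -> (a <= b)%O.
Proof.
case=> a; elim/(well_founded_ind omega1_wf): a => a IH Pa.
have [[b [ba Pb]]|nb] := pselect (exists b, (b < a)%O /\ P b); first exact: IH Pb.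
exists a; split=> // b Pb; rewrite leNgt; apply/negP => ba; apply: nb; by exists b.
Qed.

Lemma countable_upto a : countable (upto a).
Proof.
suff -> : upto a = below a `|` [set a].
  apply: countable_setU; last exact: countable1.
  by case: W_omega1 => _ _; exact.
apply/seteqP; split=> b; rewrite /upto /below /= le_eqVlt.
  by case/orP => [/eqP ->|]; [right|left].
by case=> [->|->]; rewrite ?eqxx ?orbT.
Qed.

Lemma countable_bounded (S : set W) : countable S ->
  exists b, forall x, S x -> (x < b)%O.
Proof.
move=> cS; apply: contrapT => nb; case: W_omega1 => _ + _; apply.
suff -> : [set: W] = \bigcup_(x in S) upto x.
  by apply: bigcup_countable => // x _; exact: countable_upto.
apply/seteqP; split=> // b _; apply: contrapT => nx; apply: nb; exists b => x Sx.
rewrite ltNge; apply/negP => bx; apply: nx; by exists x.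
Qed.

Lemma omega1_gt a : exists b, (a < b)%O.
Proof.
by have [b hb] := countable_bounded (countable1 a); exists b; exact: hb.
Qed.

(* The first hypothesis, that [P a u] depends only on the values of [u] below
   [a], is what allows [u] to be defined by recursion. *)
Lemma transfinite_choice (V : Type) (v0 : V) (P : W -> (W -> V) -> V -> Prop) :
  (forall a u v, (forall b, (b < a)%O -> u b = v b) ->
     forall x, P a u x -> P a v x) ->
  (forall a u, exists x, P a u x) ->
  exists u, forall a, P a u (u a).
Proof.
move=> Ploc Pex.
pose ext a (rec : forall b, (b < a)%O -> V) b :=
  if pselect (b < a)%O is left h then rec b h else v0.
pose step a rec := projT1 (cid (Pex a (ext a rec))).
pose u := Fix omega1_wf (fun _ => V) step.
have uE a : u a = step a (fun b _ => u b).
  rewrite /u Fix_eq // => x f g fg; congr step.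
  by apply: functional_extensionality_dep => b; apply: functional_extensionality_dep => h.
exists u => a; rewrite [u a]uE /step; case: cid => x /= Px.
apply: Ploc Px => b ba; rewrite /ext; by case: pselect.
Qed.

(** For unboundedness, [s x] exceeds [x] and [phi] of everything up to [x]; the least strict upper
    bound of the iterates of [s] is a closure point of [phi]. *)
Lemma club_closure (phi : W -> W) a0 :
  club [set a | (a0 < a)%O /\ forall b, (b < a)%O -> (phi b < a)%O].
Proof.
split=> [a|a [b0 b0a] lim]; last first.
  split=> [|b ba].
    by have [c [[a0c _] _ ca]] := lim _ b0a; exact: lt_trans ca.
  have [c [[_ cc] bc ca]] := lim _ ba; exact: lt_trans (cc _ bc) ca.
have nx x : exists y, (x < y)%O /\ forall b, (b <= x)%O -> (phi b < y)%O.
  have [y hy] : exists y, forall z, ([set x] `|` phi @` upto x) z -> (z < y)%O.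
    apply: countable_bounded; apply: countable_setU; first exact: countable1.
    exact/countable_image/countable_upto.
  exists y; split=> [|b bx]; apply: hy; first by left.
  by right; exists b.
have [s hs] := choice nx.
pose x n := iter n s (Order.max a0 a).
have x_lt n : (x n < x n.+1)%O by case: (hs (x n)).
have x_le m n : (m <= n)%N -> (x m <= x n)%O.
  by move=> /subnK <-; elim: (n - m)%N => // k IH; rewrite (le_trans IH)// ltW// addSn.
have cx : countable (range x).
  exact/countable_image/countableP.
have [b [hb bmin]] := omega1_min (countable_bounded cx).
have xb n : (x n < b)%O by apply: hb; exists n.
exists b; last by apply: le_lt_trans (xb 0); rewrite /x /= le_max lexx orbT.
split=> [|c cb]; first by apply: le_lt_trans (xb 0); rewrite /x /= le_max lexx.
have [n cn] : exists n, (c <= x n)%O.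
  apply: contrapT => hc; have /bmin : forall z, range x z -> (z < c)%O.
    move=> _ [n _ <-]; rewrite ltNge; apply/negP => h; apply: hc; by exists n.
  by rewrite leNgt cb.
by apply: lt_trans (xb n.+1); case: (hs (x n)) => _; exact.
Qed.

(** This injects [W * nat] into [W]: the block of [a] increases from a strict upper bound of the
    countably many earlier blocks. *)
Lemma disjoint_countable_blocks : exists c : W -> nat -> W,
  forall a b m n, c a m = c b n -> a = b /\ m = n.
Proof.
case: (pselect (exists a : W, True)) => [[a0 _]|nW]; last first.
  exists (fun a _ => a) => a; case: nW; by exists a.
have [s hs] := choice omega1_gt.
pose P a (u : W -> nat -> W) (x : nat -> W) :=
  injective x /\ forall b m n, (b < a)%O -> x n <> u b m.
have Pex a u : exists x, P a u x.
  have [b hb] : exists b, forall z,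
      (\bigcup_(b in below a) range (u b)) z -> (z < b)%O.
    apply: countable_bounded; apply: bigcup_countable.
      by case: W_omega1 => _ _; exact.
    move=> b _; exact/countable_image/countableP.
  have mono m n : (m < n)%N -> (iter m s b < iter n s b)%O.
    elim: n => // n IH; rewrite ltnS leq_eqVlt => /orP[/eqP->|/IH h].
      exact: hs.
    by apply: lt_trans h _; exact: hs.
  exists (fun n => iter n s b); split.
    move=> m n e; apply/eqP; rewrite eqn_leq; apply/andP.
    by split; rewrite leqNgt; apply/negP => /mono; rewrite e ltxx.
  move=> c m n ca e.
  have : (iter n s b < b)%O by apply: hb; exists c => //; rewrite e; exists m.
  by rewrite ltNge; case: n {e} => [|n]; rewrite ?lexx// ltW// (mono 0 n.+1).
have Ploc a u v : (forall b, (b < a)%O -> u b = v b) ->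
    forall x, P a u x -> P a v x.
  move=> uv x [x1 x2]; split=> // b m n ba; rewrite -uv//; exact: x2.
have [c hc] := transfinite_choice (fun=> a0) Ploc Pex.
exists c => a b m n e; have [ab|ba|ab] := ltgtP a b.
- by case: ((hc b).2 a m n ab).
- by case: ((hc a).2 b n m ba).
- by subst; split=> //; exact: (hc b).1 e.
Qed.

End Omega1.

(** * Points, levels and cylinders *)

Section Points.
Variables (d : Order.disp_t) (W : orderType d).

Definition coord : Type := (nat + W * nat)%type.
HB.instance Definition _ := Choice.on coord.

(** Points of C x C^omega_1 without the topology, which comes with [pspace]; until then finite lists
    of coordinates stand for neighbourhoods. *)
Definition pnt : Type := ((nat -> bool) * (W -> nat -> bool))%type.

Definition crd (x : pnt) (i : coord) : bool :=
  match i with inl n => x.1 n | inr bn => x.2 bn.1 bn.2 end.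

Definition in_level (D : set W) (i : coord) : Prop :=
  match i with inl _ => True | inr bn => D bn.1 end.

Definition eqon (D : set W) (x y : pnt) : Prop :=
  forall i, in_level D i -> crd x i = crd y i.

(** For a fixed point this is a basic clopen cylinder around it, which comes from stage [D] when
    [supp D F] holds. *)
Definition agree (F : seq coord) (x y : pnt) : Prop :=
  forall i, i \in F -> crd x i = crd y i.

Definition supp (D : set W) (F : seq coord) : Prop :=
  forall i, i \in F -> in_level D i.

Lemma in_levelS (D D' : set W) i : D `<=` D' -> in_level D i -> in_level D' i.
Proof. by move=> DD'; case: i => //= -[b n] /=; exact: DD'. Qed.

Lemma eqon_sym D x y : eqon D x y -> eqon D y x.
Proof. by move=> xy i Di; rewrite xy. Qed.

Lemma eqon_trans D y x z : eqon D x y -> eqon D y z -> eqon D x z.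
Proof. by move=> xy yz i Di; rewrite xy// yz. Qed.

Lemma eqonS D D' x y : D `<=` D' -> eqon D' x y -> eqon D x y.
Proof. by move=> DD' xy i Di; apply: xy; exact: in_levelS Di. Qed.

Lemma eqon1 D x y : eqon D x y -> x.1 = y.1.
Proof. by move=> xy; apply: funext => n; exact: (xy (inl n)). Qed.

Lemma eqon2 D x y b : eqon D x y -> D b -> x.2 b = y.2 b.
Proof. by move=> xy Db; apply: funext => n; exact: (xy (inr (b, n))). Qed.

Lemma eqonP D x y : eqon D x y <-> x.1 = y.1 /\ forall b, D b -> x.2 b = y.2 b.
Proof.
split=> [xy|[e1 e2] [n|[b n]] /= Db]; rewrite ?e1 ?e2//.
by split; [exact: eqon1 xy|move=> b; exact: eqon2 xy].
Qed.

Lemma eqonT x y : eqon setT x y -> x = y.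
Proof.
move=> /eqonP[]; case: x y => [x1 x2] [y1 y2] /= -> e.
by congr pair; apply: funext => b; exact: e.
Qed.

Lemma neqonP D x y : ~ eqon D x y -> exists2 i, in_level D i & crd x i <> crd y i.
Proof.
move=> h; apply: contrapT => hn; apply: h => i Di; apply: contrapT => ne.
by apply: hn; exists i.
Qed.

Lemma eqon_agree D F x y : supp D F -> eqon D x y -> agree F x y.
Proof. by move=> sF xy i /sF; exact: xy. Qed.

Lemma agree_sym F x y : agree F x y -> agree F y x.
Proof. by move=> xy i Fi; rewrite xy. Qed.

Lemma agree_trans F y x z : agree F x y -> agree F y z -> agree F x z.
Proof. by move=> xy yz i Fi; rewrite xy// yz. Qed.

Lemma agree_cat F F' x y : agree (F ++ F') x y <-> agree F x y /\ agree F' x y.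
Proof.
split=> [h|[h h'] i]; last by rewrite mem_cat => /orP[/h|/h'].
by split=> i Fi; apply: h; rewrite mem_cat Fi ?orbT.
Qed.

Lemma agree1 i x y : agree [:: i] x y <-> crd x i = crd y i.
Proof. by split=> [h|h j]; [exact/h/mem_head|rewrite inE => /eqP ->]. Qed.

Lemma supp_cat D F F' : supp D (F ++ F') <-> supp D F /\ supp D F'.
Proof.
split=> [h|[h h'] i]; last by rewrite mem_cat => /orP[/h|/h'].
by split=> i Fi; apply: h; rewrite mem_cat Fi ?orbT.
Qed.

Lemma supp1 D i : supp D [:: i] <-> in_level D i.
Proof. by split=> [h|h j]; [exact/h/mem_head|rewrite inE => /eqP ->]. Qed.

Lemma supp_nil D : supp D [::]. Proof. by []. Qed.

Lemma suppT F : supp setT F. Proof. by move=> [n|[b n]]. Qed.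

Lemma countable_in_level D : countable D -> countable (in_level D).
Proof.
move=> cD.
have -> : in_level D = range inl `|` inr @` (D `*` [set: nat]).
  apply/seteqP; split=> [[n|[b n]] /= h|i [[n _ <-]//|[[b n] [Db _] <-//]]].
    by left; exists n.
  by right; exists (b, n).
apply: countable_setU; apply: countable_image; first exact: countableP.
by apply: countableX => //; exact: countableP.
Qed.

End Points.

(** * Functions continuous off one point *)

Section Splitting.
Variables (d : Order.disp_t) (W : orderType d).
Implicit Types (D : set W) (F : seq (coord W)) (f chi : pnt W -> bool).

(** Continuity at [w] in the topology of stage [D]; in particular [f] is constant on the class of
    [w] under [eqon D]. *)
Definition loc_const D f (w : pnt W) : Prop :=
  exists2 F, supp D F & forall w', agree F w' w -> f w' = f w.

Lemma loc_const_eqon D f w w' : loc_const D f w -> eqon D w w' -> f w' = f w.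
Proof. by case=> F sF hF ww'; apply: hF; apply: eqon_agree (eqon_sym ww'). Qed.

Lemma loc_const_cst D b w : loc_const D (fun=> b) w.
Proof. by exists [::] => //; exact: supp_nil. Qed.

Lemma loc_const_crd D i b w : in_level D i -> loc_const D (fun w => crd w i == b) w.
Proof. by move=> Di; exists [:: i]; [exact/supp1|move=> w' /agree1 ->]. Qed.

Variables (D : set W) (p : pnt W) (T : countType).
Variable t : T -> seq (coord W) -> set (set (pnt W) * (pnt W -> bool)).
Hypothesis countable_D : countable D.
Hypothesis t_cat : forall k F F', t k (F ++ F') `<=` t k F'.

(** A pair in [t k F] is a set [A] and a pattern [chi] that [f] has to copy on [A] up to a sign.
    Such pairs must exist in every cylinder around [p], with [A] missing a smaller cylinder so that
    it fits into an annulus. *)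
Definition solvable_task k := forall F, supp D F -> exists A chi,
  [/\ t k F (A, chi), forall w, A w -> agree F w p,
      exists2 F', supp D F' & forall w, A w -> ~ agree F' w p &
      forall w, loc_const D chi w].

(* The function is [chi] up to a sign on each annulus between two consecutive
   cylinders around [p]; the n-th annulus contains a set solving the n-th
   requirement. *)
Lemma split_function : exists f,
  (forall w, ~ eqon D w p -> loc_const D f w) /\
  forall k, solvable_task k -> forall F, supp D F -> forall b, exists A chi,
    t k F (A, chi) /\ forall w, A w -> f w = b (+) chi w.
Proof.
have [e he] : exists e : nat -> coord W, range e = in_level D.
  by apply: countable_range; [exact: countable_in_level|exists (inl 0)].
have De n : in_level D (e n) by rewrite -he; exists n.
(* The number [nF.1] codes a task, a sign and a list of indices naming a cylinder. The next cylinder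
   also fixes the coordinate [e nF.1], so that the cylinders shrink to the class of [p]. *)
pose step (nF : nat * seq (coord W)) (Fx : seq (coord W) * (pnt W -> bool)) :=
  supp D nF.2 ->
  [/\ supp D Fx.1,
      forall w w', agree Fx.1 w w' -> agree (e nF.1 :: nF.2) w w',
      forall w, loc_const D Fx.2 w &
      forall k b s, unpickle nF.1 = Some (k, b, s) -> solvable_task k ->
        exists A chi, [/\ t k (map e s) (A, chi),
          forall w, A w -> agree nF.2 w p /\ ~ agree Fx.1 w p &
          Fx.2 = fun w => b (+) chi w]].
have supp_map s : supp D (map e s) by move=> _ /mapP[n _ ->]; exact: De.
have /choice[g hg] : forall nF, exists Fx, step nF Fx.
  move=> [n F]; rewrite /step /=.
  have [sF|sF] := pselect (supp D F); last by exists ([::], fun=> false).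
  have triv : [/\ supp D (e n :: F),
      forall w w', agree (e n :: F) w w' -> agree (e n :: F) w w' &
      forall w, loc_const D (fun=> false) w].
    by split=> // [i|w]; [rewrite inE => /orP[/eqP->|/sF]|exact: loc_const_cst].
  case E : (unpickle n) => [[[k b] s]|]; last first.
    by exists (e n :: F, fun=> false) => _; case: triv.
  have [ak|nak] := pselect (solvable_task k); last first.
    by exists (e n :: F, fun=> false) => _; case: triv => ? ? ?; split=> // k' b' s' [<- _ _].
  have [|A [chi [tA Ap [F' sF' AF'] cchi]]] := ak (F ++ map e s).
    by apply/supp_cat.
  exists (e n :: F ++ F', fun w => b (+) chi w) => _; split=> /=.
  - by move=> i; rewrite inE mem_cat => /or3P[/eqP->|/sF|/sF'].
  - move=> w w' h i; rewrite inE => /orP[/eqP->|iF]; apply: h.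
      by rewrite inE eqxx.
    by rewrite inE mem_cat iF orbT.
  - by move=> w; have [G sG hG] := cchi w; exists G => // w' /hG ->.
  - move=> k' b' s' [<- <- <-] _; exists A, chi; split=> //.
      exact: t_cat tA.
    move=> w Aw; split; first by have /agree_cat[] := Ap _ Aw.
    move=> h; apply: AF' (Aw) _ => i iF'; apply: h.
    by rewrite inE mem_cat iF' !orbT.
pose Fs := fix Fs n := if n is m.+1 then (g (m, Fs m)).1 else [::].
have sFs n : supp D (Fs n).
  by elim: n => [|n IH] //=; case: (hg (n, Fs n) IH).
have FsS n w w' : agree (Fs n.+1) w w' -> agree (e n :: Fs n) w w'.
  by case: (hg (n, Fs n) (sFs n)) => _ h _ _ /=; exact: h.
have Fsle m n w w' : (m <= n)%N -> agree (Fs n) w w' -> agree (Fs m) w w'.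
  move=> /subnK <-; elim: (n - m)%N => // k IH h; apply: IH.
  by move=> i iF; apply: (FsS _ _ _ h); rewrite inE iF orbT.
pose at_ n w := agree (Fs n) w p /\ ~ agree (Fs n.+1) w p.
have at_uniq m n w : at_ m w -> at_ n w -> m = n.
  move=> [m1 m2] [n1 n2]; apply/eqP; rewrite eqn_leq; apply/andP.
  split; rewrite leqNgt; apply/negP => h.
    by apply: n2; exact: Fsle m1.
  by apply: m2; exact: Fsle n1.
have at_ex w : ~ eqon D w p -> exists n, at_ n w.
  move=> /neqonP[i]; rewrite -he => -[m _ <-] ne; apply: contrapT => hn.
  have agr n : agree (Fs n) w p.
    by elim: n => // n IH; apply: contrapT => h; apply: hn; exists n.
  by apply: ne; apply: (FsS m _ _ (agr m.+1)); exact: mem_head.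
(* Only the points in the class of [p] lie in no annulus; their value is arbitrary. *)
pose f w := if pselect (exists n, at_ n w) is left h
            then (g (projT1 (cid h), Fs (projT1 (cid h)))).2 w else false.
have fE n w : at_ n w -> f w = (g (n, Fs n)).2 w.
  move=> nw; rewrite /f; case: pselect => [h|[]]; last by exists n.
  by case: cid => m /= mw; rewrite (at_uniq _ _ _ mw nw).
exists f; split=> [w /at_ex[n nw]|k ak F sF b].
  case: (hg (n, Fs n) (sFs n)) => _ _ /(_ w)[G sG hG] _.
  exists (Fs n.+1 ++ G); first exact/supp_cat.
  move=> w' /agree_cat[h1 h2]; rewrite (fE n w)// (fE n); first exact: hG.
  case: nw => n1 n2; split.
    by apply: agree_trans n1; exact: Fsle h1.
  by move=> h; apply: n2; apply: agree_trans h; exact: agree_sym.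
have [s Fs_] : exists s, F = map e s.
  elim: F sF => [|i F IH] sF; first by exists [::].
  have /IH[s ->] : supp D F by move=> j jF; apply: sF; rewrite inE jF orbT.
  have : in_level D i by apply: sF; exact: mem_head.
  by rewrite -he => -[n _ <-]; exists (n :: s).
(* The request [(k, b, s)] was served in the annulus numbered by its code. *)
pose n := pickle (k, b, s).
have [_ _ _ /(_ k b s)] := hg (n, Fs n) (sFs n).
rewrite /= pickleK => /(_ erefl ak)[A [chi [tA Aat eg]]].
exists A, chi; rewrite Fs_; split=> // w Aw.
by rewrite (fE n); [rewrite eg|exact: Aat].
Qed.

End Splitting.

(** * Guessing sequences of pairs of points *)

Section DiamondSequences.
Variables (d : Order.disp_t) (W : orderType d).
Hypothesis W_omega1 : is_omega1 W.
Implicit Types (a b c : W).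

(* The blocks of [disjoint_countable_blocks] are indexed by the larger of the
   two elements of W to be coded. *)
Lemma sequence_coding : exists k : W -> bool -> coord W -> W,
  forall a s i a' s' i', k a s i = k a' s' i' -> [/\ a = a', s = s' & i = i'].
Proof.
have [c hc] := disjoint_countable_blocks W_omega1.
have /choice[r hr] : forall a, exists f : W -> nat, {in upto a &, injective f}.
  by move=> a; have /countable_injP[f fi] := countable_upto W_omega1 a; exists f.
pose lev a (i : coord W) := if i is inr bn then Order.max a bn.1 else a.
pose sub m (i : coord W) : (nat + nat * nat)%type :=
  match i with inl n => inl n | inr bn => inr (r m bn.1, bn.2) end.
exists (fun a s i => c (lev a i) (pickle (r (lev a i) a, s, sub (lev a i) i))).
move=> a s i a' s' i' /hc[el] /(pcan_inj pickleK)[]; rewrite -el => era -> esub.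
have le_lev b j : upto (lev b j) b.
  by rewrite /upto /lev /=; case: j => [n|[c' n]] /=; rewrite ?lexx// le_max lexx.
have la : upto (lev a i) a by [].
have la' : upto (lev a i) a' by rewrite el.
split=> //; first by apply: (hr (lev a i)) => //; exact/mem_set.
case: i i' el {era la la'} esub => [n|[b n]] [m|[b' m]] //=; first by move=> _ [->].
move=> el [erb ->]; congr (inr (_, _)).
by apply: (hr (Order.max a b)) => //; apply/mem_set; rewrite /upto /=; [|rewrite el];
  rewrite le_max lexx orbT.
Qed.

Hypothesis W_diamond : diamond W.

(** A sequence of pairs is coded by the set [B] of the codes of its true coordinates. At a stage [a]
    closed under the coding, [A a] decodes to the correct coordinates below [a]; stationarity gives
    such a stage that is also closed under [phi]. *)
Lemma diamond_sequences :
  exists qh : W -> W -> pnt W * pnt W,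
    forall (q : W -> pnt W * pnt W) (phi : W -> W) a0, exists a,
    [/\ (a0 < a)%O,
        forall b, (b < a)%O -> (phi b < a)%O &
        forall b, (b < a)%O -> eqon (below a) (qh a b).1 (q b).1 /\
                               eqon (below a) (qh a b).2 (q b).2].
Proof.
have [k hk] := sequence_coding.
have [A [_ hA]] := W_diamond.
pose side (s : bool) (x : pnt W * pnt W) := if s then x.1 else x.2.
pose dec a b s : pnt W := (fun n => `[< A a (k b s (inl n)) >],
                       fun c n => `[< A a (k b s (inr (c, n))) >]).
have decE a b s i : crd (dec a b s) i = `[< A a (k b s i) >].
  by case: i => [n|[c n]].
exists (fun a b => (dec a b true, dec a b false)) => q phi a0.
pose B : set W := [set x | exists b s i, x = k b s i /\ crd (side s (q b)) i].
(* Closure under [psi] puts below [a] the code of every coordinate at a level below [a] of a member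
   with index below [a]. *)
have /choice[psi hpsi] : forall x, exists y, (phi x < y)%O /\
    forall b s i, (b <= x)%O -> in_level (upto x) i -> (k b s i < y)%O.
  move=> x.
  have [y hy] : exists y, forall z, ([set phi x] `|`
      (fun bsi => k bsi.1 bsi.2.1 bsi.2.2) @` (upto x `*`
        ([set: bool] `*` in_level (upto x)))) z ->
      (z < y)%O.
    apply/(countable_bounded W_omega1)/countable_setU; first exact: countable1.
    apply: countable_image; apply: countableX; first exact: countable_upto.
    apply: countableX; first exact: countableP.
    exact/countable_in_level/countable_upto.
  exists y; split; first by apply: hy; left.
  by move=> b s i bx ix; apply: hy; right; exists (b, (s, i)).
have [a [/= eA [a0a cl]]] := hA B _ (club_closure W_omega1 psi a0).
exists a; split=> //.
  by move=> b ba; case: (hpsi b) => h _; apply: lt_trans h _; exact: cl.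
have kA b s i : (b < a)%O -> in_level (below a) i ->
    crd (dec a b s) i = crd (side s (q b)) i.
  move=> ba ia; rewrite decE -eA.
  have ka : (k b s i < a)%O.
    pose m := if i is inr cn then Order.max b cn.1 else b.
    have ma : (m < a)%O.
      by rewrite /m; case: i ia {m} => [n|[c n]] //=; rewrite /below /= gt_max ba.
    apply: lt_trans (cl _ ma); apply: (hpsi m).2; rewrite /m.
      by case: i {ia m ma} => [n|[c n]] //=; rewrite le_max lexx.
    by case: i {ia m ma} => [n|[c n]] //=; rewrite /upto /= le_max lexx orbT.
  apply/asboolP/idP => [[[b' [s' [i' [/hk[-> -> ->]]]]] //]|h].
  by split=> //; exists b, s, i.
by move=> b ba; split=> i ia; [exact: (kA b true)|exact: (kA b false)].
Qed.

End DiamondSequences.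

(** * The product topology in terms of cylinders *)

Section PointTopology.
Variables (d : Order.disp_t) (W : orderType d).

Definition pspace : topologicalType :=
  (cantor_space * prod_topology (fun _ : W => cantor_space))%type.

Lemma cvg_prod_topology (X : Type) (F : set_system X) (J : Type)
    (T : J -> topologicalType) (f : X -> prod_topology T) (l : prod_topology T) :
  Filter F -> (forall j (A : set (T j)), open A -> A (l j) -> F [set x | A (f x j)]) ->
  f @ F --> l.
Proof.
move=> FF h; apply/cvg_sup => j U [V] [[A] oA <-] /= Al VU.
by apply: (filterS VU); exact: (h j A oA Al).
Qed.

Lemma coord_continuous (i : coord W) :
  continuous ((fun x : pspace => crd (x : pnt W) i) : pspace -> bool).
Proof.
move=> x; case: i => [n|[b n]] /=.
  apply: (@continuous_comp pspace cantor_space bool fst (fun y => y n)).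
    exact: (@cvg_fst _ _ (nbhs x.1) (nbhs x.2)).
  exact: (@proj_continuous _ (fun _ : nat => bool) n).
apply: (@continuous_comp pspace cantor_space bool (fun x => x.2 b) (fun y => y n)).
  apply: (@continuous_comp pspace (prod_topology (fun _ : W => cantor_space))
    cantor_space snd (fun y => y b)).
    exact: (@cvg_snd _ _ (nbhs x.1) (nbhs x.2)).
  exact: (@proj_continuous _ (fun _ : W => cantor_space) b).
exact: (@proj_continuous _ (fun _ : nat => bool) n).
Qed.

Lemma nbhs_pspace (x : pspace) (U : set pspace) :
  nbhs x U <-> exists F, forall y : pnt W, agree F y x -> U y.
Proof.
split; last first.
  case=> F FU; suff h : nbhs x [set y : pspace | agree F (y : pnt W) x].
    by apply: filterS h; exact: FU.
  elim: F {FU} => [|i F IH]; first by apply: filterS filterT.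
  have hi : nbhs x [set y : pspace | crd (y : pnt W) i = crd (x : pnt W) i].
    have := @coord_continuous i x [set crd (x : pnt W) i]; apply.
    by rewrite nbhs_principalE; apply/principal_filterP.
  apply: filterS (filterI hi IH) => y [/= yi yF] j.
  by rewrite inE => /orP[/eqP->|/yF].
(* The filter [Phi] is generated by the cylinders at [x]. It contains every neighbourhood of [x]
   because it converges to [x] in each coordinate. *)
pose Phi : set_system pspace := [set U | exists F, forall y : pnt W, agree F y x -> U y].
have FPhi : Filter Phi.
  split; first by exists [::].
    move=> A B [F FA] [F' FB]; exists (F ++ F') => y /agree_cat[/FA Ay /FB By].
    by [].
  by move=> A B AB [F FA]; exists F => y /FA/AB.
have one (i : coord W) (A : set bool) : A (crd (x : pnt W) i) ->
    Phi [set y : pspace | A (crd (y : pnt W) i)].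
  by move=> Ai; exists [:: i] => y /agree1 yi /=; rewrite yi.
have h1 : fst @ Phi --> x.1.
  by apply: cvg_prod_topology => n A _ An; exact: (one (inl n)).
have h2 : snd @ Phi --> x.2.
  apply: cvg_prod_topology => b A oA Ab.
  have : (fun y : pspace => y.2 b) @ Phi --> (x.2 b : cantor_space).
    by apply: cvg_prod_topology => n B _ Bn; exact: (one (inr (b, n))).
  by apply; exact: open_nbhs_nbhs.
move=> [[P Q] [/= /h1 P1 /h2 P2] PQU].
have [F hF] : Phi [set y | P y.1 /\ Q y.2] by exact: filterI.
by exists F => -[y1 y2] /hF h; exact: PQU.
Qed.

Lemma nbhs_cantor (x : cantor_space) (U : set cantor_space) :
  nbhs x U <-> exists s : seq nat, forall y : cantor_space,
    (forall k, k \in s -> y k = x k) -> U y.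
Proof.
split=> [xU|[s hs]].
  pose Phi : set_system cantor_space := [set U | exists s : seq nat,
    forall y : cantor_space, (forall k, k \in s -> y k = x k) -> U y].
  suff: id @ Phi --> x by apply.
  apply: cvg_prod_topology.
    split; first by exists [::].
      move=> A B [s hA] [t hB]; exists (s ++ t) => y h; split.
        by apply: hA => k ks; apply: h; rewrite mem_cat ks.
      by apply: hB => k ks; apply: h; rewrite mem_cat ks orbT.
    by move=> A B AB [s hA]; exists s => y /hA/AB.
  by move=> n A _ An; exists [:: n] => y h /=; rewrite h ?mem_head.
have : nbhs x [set y : cantor_space | forall k, k \in s -> y k = x k].
  elim: s {hs} => [|n s IH]; first by apply: filterS filterT.
  have hn : nbhs x [set y : cantor_space | y n = x n].
    have := @proj_continuous _ (fun _ : nat => bool) n x [set x n]; apply.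
    by rewrite nbhs_principalE; apply/principal_filterP.
  apply: filterS (filterI hn IH) => y [/= yn ys] j.
  by rewrite inE => /orP[/eqP->|/ys].
by apply: filterS => y /hs.
Qed.

Lemma pspace_compact : compact [set: pspace].
Proof.
rewrite -setXTT; apply: compact_setX; first exact: cantor_space_compact.
have := @tychonoff _ (fun _ : W => cantor_space) (fun=> setT) (fun=> cantor_space_compact).
by congr (compact _); rewrite eqEsubset.
Qed.

Variable X : set pspace.

Lemma nbhs_subset_type (x : X) (U : set X) :
  nbhs x U <-> exists F, forall y : X, agree F (set_val y : pnt W) (set_val x) -> U y.
Proof.
split.
  case=> _ [[V oV <-] Vx VU].
  have /nbhs_pspace[F hF] : nbhs (set_val x : pspace) V by exact: open_nbhs_nbhs.
  by exists F => y /hF; exact: VU.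
case=> F hF.
have h : nbhs (set_val x : pspace) [set y : pspace | agree F (y : pnt W) (set_val x)].
  by apply/nbhs_pspace; exists F.
have /(_ _ h) := @initial_continuous X pspace set_val x.
by apply: (@filterS X (nbhs x)) => y; exact: hF.
Qed.

End PointTopology.

(** * The group action and the stages of the inverse system *)

Section Action.
Variables (d : Order.disp_t) (W : orderType d).
Variables (G : groupType) (rho : G -> (nat -> bool) -> (nat -> bool)).
Variables (e : nat -> G) (idx : G -> nat).
Hypothesis rho1 : forall x, rho 1%g x = x.
Hypothesis rhoM : forall g h x, rho (g * h)%g x = rho g (rho h x).
Hypothesis rho_cont : forall g x n, exists s : seq nat,
  forall y, (forall k, k \in s -> y k = x k) -> rho g y n = rho g x n.
Hypothesis rho_free : forall g x, rho g x = x -> g = 1%g.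
Hypothesis idxK : cancel idx e.
Implicit Types (a b : W) (D : set W) (F : seq (coord W)) (x y z w : pnt W).

(* Coordinate [idx h] at a stage is the coordinate indexed by the group
   element h, on which G acts by left translation. *)
Definition act (g : G) x : pnt W :=
  (rho g x.1, fun a n => x.2 a (idx (g^-1 * e n)%g)).

(* On [normal] points the coordinates not of the form [idx h] are redundant. *)
Definition normal x : Prop := forall a n, x.2 a n = x.2 a (idx (e n)).

Lemma actM g h x : act (g * h)%g x = act g (act h x).
Proof.
rewrite /act /= rhoM; congr pair; apply: funext => a; apply: funext => n.
by rewrite idxK invgM mulgA.
Qed.

Lemma act1 x : normal x -> act 1%g x = x.
Proof.
case: x => x1 x2 nx; rewrite /act /= rho1; congr pair.
by apply: funext => a; apply: funext => n; rewrite invg1 mul1g; exact/esym/nx.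
Qed.

Lemma actVK g x : normal x -> act g (act g^-1%g x) = x.
Proof. by move=> nx; rewrite -actM mulgV act1. Qed.

Lemma actKV g x : normal x -> act g^-1%g (act g x) = x.
Proof. by move=> nx; rewrite -actM mulVg act1. Qed.

Lemma normal_act g x : normal (act g x).
Proof. by move=> a n; rewrite /act /= idxK. Qed.

Lemma act_coord g x a : (act g x).2 a (idx 1%g) = x.2 a (idx g^-1%g).
Proof. by rewrite /act /= idxK mulg1. Qed.

Lemma eqon_act D g x y : eqon D x y -> eqon D (act g x) (act g y).
Proof.
move=> /eqonP[e1 e2]; apply/eqonP; split=> [|b Db]; first by rewrite /= e1.
by apply: funext => n; rewrite /= e2.
Qed.

Lemma eqon_actV D g x y : normal x -> normal y ->
  eqon D (act g x) (act g y) -> eqon D x y.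
Proof. by move=> nx ny /(eqon_act (g^-1%g)); rewrite !actKV. Qed.

(** Freeness enters here: at most one translate of [x] lies over the split point, so each stage has
    at most one ambiguous coordinate at [x]. *)
Lemma eqon_act_inj D g h x y : eqon D (act g x) y -> eqon D (act h x) y -> g = h.
Proof.
move=> /eqon1 gx /eqon1 hx; have := etrans gx (esym hx); rewrite /= => gh.
have /rho_free/(congr1 (mul h)) : rho (h^-1 * g)%g x.1 = x.1.
  by rewrite rhoM gh -rhoM mulVg rho1.
by rewrite mulgA mulgV mul1g mulg1.
Qed.

Lemma agree_gather D z (Q : pnt W -> Prop) F :
  (forall i, i \in F -> exists2 F', supp D F' &
     forall w, Q w -> agree F' w z -> crd w i = crd z i) ->
  exists2 F', supp D F' & forall w, Q w -> agree F' w z -> agree F w z.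
Proof.
elim: F => [|i F IH] h; first by exists [::].
have [F1 s1 h1] := h i (mem_head _ _).
have [j jF|F2 s2 h2] := IH; first by apply: h; rewrite inE jF orbT.
exists (F1 ++ F2); first exact/supp_cat.
move=> w Qw /agree_cat[a1 a2] j; rewrite inE => /orP[/eqP->|jF]; first exact: h1.
exact: h2 jF.
Qed.

Lemma act_cont D g x F : supp D F -> exists2 F', supp D F' &
  forall w, agree F' w x -> agree F (act g w) (act g x).
Proof.
elim: F => [|i F IH] sF; first by exists [::].
have [j jF|F1 s1 h1] := IH; first by apply: sF; rewrite inE jF orbT.
have [F2 s2 h2] : exists2 F', supp D F' &
    forall w, agree F' w x -> crd (act g w) i = crd (act g x) i.
  have := sF i (mem_head _ _); case: i {sF} => [n|[b n]] Db /=.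
    have [s hs] := rho_cont g x.1 n.
    exists (map inl s) => [_ /mapP[k _ ->] //|w h]; apply: hs => k ks.
    by apply: (h (inl k)); apply: map_f.
  exists [:: inr (b, idx (g^-1 * e n)%g)]; first exact/supp1.
  by move=> w /agree1.
exists (F1 ++ F2); first exact/supp_cat.
move=> w /agree_cat[a1 a2] j; rewrite inE => /orP[/eqP->|jF]; first exact: h2.
exact: h1 jF.
Qed.

(** [(u b).1] is the point whose orbit is split at stage [b], and [(u b).2] is the splitting
    function. *)
Definition data := W -> pnt W * (pnt W -> bool).
Implicit Types (u v : data).

(** Imposed on all translates of a normal [x], it prescribes the coordinate [idx g] at [b] as the
    splitting function at the translate of [x] by the inverse of [g], and leaves it free where that
    is the split point. *)
Definition rule u b x : Prop :=
  ~ eqon (below b) x (u b).1 -> x.2 b (idx 1%g) = (u b).2 x.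

(* The inverse limit of the stages in D, as a set of points whose coordinates
   outside D are unconstrained. *)
Definition Xlev u D : set (pnt W) :=
  [set x | normal x /\ forall b, D b -> forall g, rule u b (act g x)].

Lemma Xlev_normal u D x : Xlev u D x -> normal x. Proof. by case. Qed.

Lemma XlevS u D D' : D `<=` D' -> Xlev u D' `<=` Xlev u D.
Proof. by move=> DD' x [nx Rx]; split=> // b /DD'; exact: Rx. Qed.

Lemma Xlev_act u D g x : Xlev u D x -> Xlev u D (act g x).
Proof.
move=> [nx Rx]; split; first exact: normal_act.
by move=> b Db h; rewrite -actM; exact: Rx.
Qed.

Lemma Xlev_coord u D x a g : Xlev u D x -> D a ->
  ~ eqon (below a) (act g^-1%g x) (u a).1 ->
  x.2 a (idx g) = (u a).2 (act g^-1%g x).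
Proof. by move=> [_ Rx] Da /(Rx a Da (g^-1%g)); rewrite act_coord invgK. Qed.

Lemma Xlev_ext u v D : (forall b, D b -> u b = v b) -> Xlev u D = Xlev v D.
Proof.
move=> uv; apply/seteqP; split=> x [nx Rx]; split=> // b Db g.
  by have := Rx b Db g; rewrite /rule uv.
by have := Rx b Db g; rewrite /rule uv.
Qed.

(* Asking for a whole fibre, and not just for a point, of the projection from
   level D to level D0 is what survives both splittings and limits. *)
Definition fibre_limit u D (S : set (pnt W)) D0 z : Prop :=
  forall F, supp D F -> exists s, [/\ S s, ~ eqon D0 s z &
    forall w, Xlev u D w -> eqon D0 w s -> agree F w z].

Lemma fibre_limit_eqon u D S D0 z z' : D0 `<=` D -> eqon D z z' ->
  fibre_limit u D S D0 z -> fibre_limit u D S D0 z'.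
Proof.
move=> DD zz h F sF; have [s [Ss nsz hs]] := h F sF; exists s; split=> //.
  by move=> sz'; apply: nsz; apply: eqon_trans sz' _; apply/eqon_sym/(eqonS DD).
by move=> w Xw ws; apply: agree_trans (hs w Xw ws) _; exact: eqon_agree zz.
Qed.

(** * A single splitting step *)

Section Stage.
Variables (u : data) (a : W).
Let p := (u a).1.
Let f := (u a).2.
Hypothesis f_cont : forall w, ~ eqon (below a) w p -> loc_const (below a) f w.

Lemma below_upto : below a `<=` upto a.
Proof. by move=> b /ltW. Qed.

Lemma in_upto i : in_level (upto a) i ->
  in_level (below a) i \/ exists n, i = inr (a, n).
Proof.
case: i => [n|[b n]] /=; first by left.
by rewrite /upto /= le_eqVlt => /orP[/eqP->|]; [right; exists n|left].
Qed.

Lemma coord_cont z n : Xlev u (upto a) z ->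
  ~ eqon (below a) (act (e n)^-1%g z) p ->
  exists2 F, supp (below a) F & forall w, Xlev u (upto a) w -> agree F w z ->
    crd w (inr (a, n)) = crd z (inr (a, n)).
Proof.
move=> Xz nz; have aa : upto a a by rewrite /upto /=.
have [F1 s1 h1] := f_cont nz.
have /neqonP[i Di ni] := nz.
have [|F s h] := @act_cont (below a) (e n)^-1%g z (i :: F1).
  by move=> j; rewrite inE => /orP[/eqP->|/s1].
exists F => // w Xw /h hw.
have nw : ~ eqon (below a) (act (e n)^-1%g w) p.
  by move=> /(_ i Di); rewrite hw ?mem_head.
rewrite /= (Xlev_normal Xz) (Xlev_normal Xw) (Xlev_coord Xz)// (Xlev_coord Xw)//.
by apply: h1 => j jF; apply: hw; rewrite inE jF orbT.
Qed.

Lemma nbhs_off_orbit z F : Xlev u (upto a) z ->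
  (forall g, ~ eqon (below a) (act g z) p) -> supp (upto a) F ->
  exists2 F', supp (below a) F' &
    forall w, Xlev u (upto a) w -> agree F' w z -> agree F w z.
Proof.
move=> Xz nz sF; apply: agree_gather => i /sF/in_upto[Di|[n ->]].
  by exists [:: i]; [exact/supp1|move=> w _ /agree1].
by apply: coord_cont => //; exact: nz.
Qed.

(** By [eqon_act_inj], [coord_cont] applies to every coordinate of stage [a] except the one indexed
    by [g], which alone has to be matched separately. *)
Lemma nbhs_on_orbit z g F : Xlev u (upto a) z ->
  eqon (below a) (act g^-1%g z) p -> supp (upto a) F ->
  exists2 F', supp (below a) F' &
    forall w, Xlev u (upto a) w -> w.2 a (idx g) = z.2 a (idx g) ->
      agree F' w z -> agree F w z.
Proof.
move=> Xz gz sF.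
suff [F' sF' h] : exists2 F', supp (below a) F' & forall w,
    Xlev u (upto a) w /\ w.2 a (idx g) = z.2 a (idx g) ->
    agree F' w z -> agree F w z.
  by exists F' => // w Xw cw; apply: h.
apply: agree_gather => i /sF/in_upto[Di|[n ->]].
  by exists [:: i]; [exact/supp1|move=> w _ /agree1].
have [eng|neg] := pselect (e n = g).
  exists [::] => // w [Xw cw] _ /=.
  by rewrite (Xlev_normal Xw) (Xlev_normal Xz) eng.
have [|F' s' h'] := coord_cont Xz (n := n); last by exists F' => // w [Xw _]; exact: h'.
by move=> /(eqon_act_inj gz)/invg_inj gn; apply: neg.
Qed.

(** If [z] is not over the split orbit, its neighbourhoods come from below [a]. Otherwise a single
    extra coordinate has to be matched, and the hypothesis on [g] provides fibres on which the
    splitting function has the desired constant value. *)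
Lemma fibre_limit_split S D0 z : D0 `<=` below a -> Xlev u (upto a) z ->
  (forall g, fibre_limit u (below a) S D0 (act g p) ->
     forall F c, supp (below a) F ->
     exists s, [/\ S s, ~ eqon D0 s (act g p) &
       forall w, Xlev u (below a) w -> eqon D0 w s ->
         agree F (act g^-1%g w) p /\ f (act g^-1%g w) = c]) ->
  fibre_limit u (below a) S D0 z -> fibre_limit u (upto a) S D0 z.
Proof.
move=> D0a Xz task lim F sF.
have [[g gz]|ng] := pselect (exists g, eqon (below a) (act g z) p); last first.
  have [g gz|F' sF' hF'] := nbhs_off_orbit Xz _ sF; first by apply: ng; exists g.
  have [s [Ss nsz hs]] := lim F' sF'; exists s; split=> // w Xw ws.
  by apply: hF' => //; apply: hs => //; apply: XlevS Xw; exact: below_upto.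
have [h gh] : exists h, g = h^-1%g by exists g^-1%g; rewrite invgK.
subst g; have nz := Xlev_normal Xz.
have zhp : eqon (below a) z (act h p).
  by have := eqon_act h gz; rewrite actVK.
have [F' sF' hF'] := nbhs_on_orbit Xz gz sF.
have [F1 sF1 hF1] := act_cont h p sF'.
have [|s [Ss nsp hs]] := task h _ F1 (z.2 a (idx h)) sF1.
  exact: fibre_limit_eqon zhp lim.
have hpz : eqon D0 (act h p) z by apply/eqon_sym/(eqonS D0a).
exists s; split=> //.
  by move=> sz; apply: nsp; apply: eqon_trans sz _; exact: eqon_sym.
move=> w Xw ws.
have nw := Xlev_normal Xw.
have [wp fw] := hs w (XlevS below_upto Xw) ws.
apply: hF' => //.
  rewrite (Xlev_coord Xw)//; first by rewrite /upto /=.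
  move=> whp; apply: nsp; apply: eqon_trans (eqon_sym ws) _.
  by apply: (eqonS D0a); have := eqon_act h whp; rewrite actVK.
rewrite -(actVK h nw); apply: agree_trans (hF1 _ wp) _.
exact: eqon_agree (eqon_sym zhp).
Qed.

End Stage.


(** * Guessed relations and the choice of the splittings *)

Hypothesis W_omega1 : is_omega1 W.

(* [Gam a] is the relation between points of stage a guessed by diamond. *)
Variable Gam : W -> set (pnt W * pnt W).

Definition Sdom a : set (pnt W) := [set x | exists y, Gam a (x, y)].

(* [c] is a colour: a value of the function splitting the orbit at stage a. *)
Definition Scol u a (c : bool) : set (pnt W) :=
  [set x | exists y, [/\ Gam a (x, y), ~ eqon (below a) y (u a).1 & (u a).2 y = c]].

(** The pair [(set0, setT)] makes the projection to the Cantor set irreducible. [Sdom b] is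
    respected from stage [b] on, [Scol u b c] only at later stages, since its colours are decided at
    [b]. *)
Definition constraints u a : set (set W * set (pnt W)) :=
  [set (set0, setT)] `|` ((fun b => (below b, Sdom b)) @` upto a `|`
   (fun bc => (below bc.1, Scol u bc.1 bc.2)) @` (below a `*` [set: bool])).

Lemma countable_constraints u a : countable (constraints u a).
Proof.
apply: countable_setU; first exact: countable1.
apply: countable_setU; apply: countable_image; first exact: countable_upto.
by apply: countableX; [case: W_omega1 => _ _; exact|exact: countableP].
Qed.

Lemma constraints_below u a DS : constraints u a DS -> DS.1 `<=` below a.
Proof.
case=> [->|[[b ba <-]|[[b c] [/= ba _] <-]]] x //= xb.
  exact: lt_le_trans ba.
exact: lt_trans ba.
Qed.

Lemma constraints_ext u v a : (forall b, (b < a)%O -> u b = v b) ->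
  constraints u a = constraints v a.
Proof.
move=> uv; congr (_ `|` (_ `|` _)); apply/seteqP.
by split=> _ [[b c] [ba _] <-]; exists (b, c) => //=; rewrite /Scol /= uv.
Qed.

(** The last clause keeps [(x', y')] off the graph of [g]. That [x'] differs from [x] is stated
    after translation by [g], because a guessed point need not be [normal] and then [actKV] does not
    apply to it. *)
Definition clusters a x y : Prop :=
  forall F g, supp (below a) F -> exists x' y', [/\ Gam a (x', y'),
    agree F x' x /\ agree F y' y,
    ~ eqon (below a) (act g x') (act g x), ~ eqon (below a) y' y &
    ~ eqon (below a) y' (act g x')].

Definition good u a : Prop :=
  [/\ forall w, ~ eqon (below a) w (u a).1 -> loc_const (below a) (u a).2 w,
      forall D0 S, constraints u a (D0, S) -> forall z, Xlev u (upto a) z ->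
        fibre_limit u (below a) S D0 z -> fibre_limit u (upto a) S D0 z &
      (exists x y, [/\ Xlev u (below a) x, Xlev u (below a) y & clusters a x y]) ->
      exists2 x, Xlev u (below a) x & forall c z, Xlev u (upto a) z ->
        eqon (below a) z x -> fibre_limit u (upto a) (Scol u a c) (below a) z].

Lemma good_ext u v a : (forall b, (b <= a)%O -> u b = v b) -> good u a -> good v a.
Proof.
move=> uv; have uv' b : (b < a)%O -> u b = v b by move=> /ltW; exact: uv.
rewrite /good /fibre_limit (constraints_ext uv') !(Xlev_ext (v := v))//.
by rewrite /Scol uv.
Qed.

Definition upd u a xf : data := fun b => if b == a then xf else u b.

Lemma updE u a xf : upd u a xf a = xf. Proof. by rewrite /upd eqxx. Qed.

Lemma upd_lt u a xf b : (b < a)%O -> upd u a xf b = u b.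
Proof. by rewrite /upd; case: eqP => // ->; rewrite ltxx. Qed.

(** Besides the requests [ext] of the case at hand, there is one task for each constraint and group
    element: its sets are translates of whole fibres over points of [S], with a constant pattern.
    This yields the hypothesis of [fibre_limit_split]. *)
Lemma stage_split u a p (ext : bool -> seq (coord W) -> set (set (pnt W) * (pnt W -> bool))) :
  normal p -> (forall k F F', ext k (F ++ F') `<=` ext k F') ->
  exists f, let u' := upd u a (p, f) in
  [/\ forall w, ~ eqon (below a) w p -> loc_const (below a) f w,
      forall D0 S, constraints u' a (D0, S) -> forall z, Xlev u' (upto a) z ->
        fibre_limit u' (below a) S D0 z -> fibre_limit u' (upto a) S D0 z &
      forall k, solvable_task (below a) p ext k -> forall F, supp (below a) F ->
        forall c, exists A chi, ext k F (A, chi) /\ forall w, A w -> f w = c (+) chi w].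
Proof.
move=> np ext_cat.
have [cs hcs] : exists cs : nat -> set W * set (pnt W), range cs = constraints u a.
  apply: countable_range; first exact: countable_constraints.
  by exists (set0, setT); left.
pose fib (n m : nat) : set (set (pnt W)) := [set A | exists s,
  [/\ (cs n).2 s, ~ eqon (cs n).1 s (act (e m) p) &
  A = [set w | exists w', [/\ Xlev u (below a) w', eqon (cs n).1 w' s &
                              w = act (e m)^-1%g w']]]].
pose t (k : (nat * nat + bool)%type) F : set (set (pnt W) * (pnt W -> bool)) :=
  match k with
  | inl nm => [set Ac | [/\ fib nm.1 nm.2 Ac.1, forall w, Ac.1 w -> agree F w p &
                            Ac.2 = fun=> false]]
  | inr b => ext b F
  end.
have t_cat k F F' : t k (F ++ F') `<=` t k F'.
  case: k => [[n m]|b] /=; last exact: ext_cat.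
  by move=> Ac [fA Ap c0]; split=> // w /Ap/agree_cat[].
have cb : countable (below a) by case: W_omega1 => _ _; exact.
have [f [f_cont f_task]] := split_function p cb t_cat.
exists f => u'; split=> //; last by move=> k; exact: (f_task (inr k)).
have uu' b : below a b -> u b = u' b by move=> ba; rewrite /u' upd_lt.
move=> D0 S; rewrite -(constraints_ext uu') => cDS z Xz.
have D0a := constraints_below cDS.
have ua : u' a = (p, f) by rewrite /u' updE.
apply: (@fibre_limit_split u' a) => //; rewrite ua //= => g lim F c sF.
have [n _ csn] : range cs (D0, S) by rewrite hcs.
have [|A [chi []]] := f_task (inl (n, idx g)) _ F sF c; last first.
  move=> /= [[s []]]; rewrite csn idxK /= => Ss ns Ae Ap -> fA.
  exists s; split=> // w Xw ws.
  have Aw : A (act g^-1%g w) by rewrite Ae; exists w; split; rewrite ?(Xlev_ext uu').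
  split; first exact: Ap.
  by rewrite fA// addbF.
move=> F' sF'.
have [F1 sF1 hF1] := act_cont g^-1%g (act g p) sF'.
have [s [Ss ns hs]] := lim F1 sF1.
exists [set w | exists w', [/\ Xlev u (below a) w', eqon (cs n).1 w' s &
                              w = act g^-1%g w']], (fun=> false).
have agr w : Xlev u (below a) w -> eqon D0 w s -> agree F' (act g^-1%g w) p.
  move=> Xw ws; rewrite -[X in agree _ _ X](actKV g np); apply: hF1.
  by apply: hs; rewrite -?(Xlev_ext uu').
split=> /=.
- split=> //; last by move=> _ [w [Xw ws ->]]; apply: agr; rewrite ?csn in ws.
  by rewrite /fib /= idxK; exists s; rewrite csn.
- by move=> _ [w [Xw ws ->]]; apply: agr; rewrite ?csn in ws.
(* [s] and [act g p] differ at some [i] in [D0], where the whole fibre has the value of [s]; hence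
   the translated fibre misses a cylinder around [p]. *)
- have /neqonP[i Di ni] := ns.
  have [|F2 sF2 hF2] := act_cont g p (F := [:: i]) (D := below a).
    by apply/supp1; exact: in_levelS Di.
  exists F2 => // _ [w [Xw ws ->]] /hF2/agree1; rewrite actVK; last exact: Xlev_normal Xw.
  by rewrite csn in ws; rewrite ws.
- by move=> w; exact: loc_const_cst.
Qed.

Lemma good_stage_trivial a u :
  (forall x y, Xlev u (below a) x -> Xlev u (below a) y -> ~ clusters a x y) ->
  exists xf, good (upd u a xf) a.
Proof.
(* The third clause of [good] is vacuous here, and any normal point can be split. *)
move=> nacc; pose p : pnt W := (fun=> false, fun _ _ => false).
have [//|f [f_cont pres _]] :=
  @stage_split u a p (fun _ _ => set0) _ (fun _ _ _ _ h => h).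
exists (p, f); split=> //; first by rewrite updE.
have uu' b : below a b -> upd u a (p, f) b = u b by move=> ba; rewrite upd_lt.
by case=> x [y [Xx Xy /nacc[]]]; rewrite -(Xlev_ext uu').
Qed.

(** The orbit of [y] is split and [x] lies off it, so the neighbourhoods of points over [x] come
    from below [a]. It suffices to give the colour [c] to single points [y'] whose partners [x']
    approach [x]. *)
Lemma good_stage_off_orbit a u x y : Xlev u (below a) x -> Xlev u (below a) y ->
  clusters a x y -> (forall g, ~ eqon (below a) (act g x) y) ->
  exists xf, good (upd u a xf) a.
Proof.
move=> Xx Xy acc xy.
pose ext (_ : bool) F : set (set (pnt W) * (pnt W -> bool)) :=
  [set Ac | exists x' y', [/\ Gam a (x', y'), agree F x' x, agree F y' y /\
    ~ eqon (below a) x' x, ~ eqon (below a) y' y & Ac = ([set y'], fun=> false)]].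
have ext_cat k F F' : ext k (F ++ F') `<=` ext k F'.
  move=> Ac [x' [y' [Gxy /agree_cat[_ h1] [/agree_cat[_ h2] h3] h4 ->]]].
  by exists x', y'.
have [f [f_cont pres task]] := @stage_split u a y ext (Xlev_normal Xy) ext_cat.
have ext_solvable : solvable_task (below a) y ext true.
  move=> F sF; have [x' [y' [Gxy [ax ay] nx ny _]]] := acc F 1%g sF.
  exists [set y'], (fun=> false); split.
  - by exists x', y'; split=> //; split=> // /(eqon_act 1%g).
  - by move=> _ ->.
  - have /neqonP[i Di ni] := ny.
    by exists [:: i]; [exact/supp1|move=> _ -> /agree1].
  - by move=> w; exact: loc_const_cst.
exists (y, f); set u' := upd u a (y, f) in pres *.
have uu' b : below a b -> u' b = u b by move=> ba; rewrite /u' upd_lt.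
have ua : u' a = (y, f) by rewrite /u' updE.
split=> //; first by rewrite ua.
move=> _; exists x; first by rewrite (Xlev_ext uu').
move=> c z Xz zx F sF.
have [| |F' sF' hF'] := nbhs_off_orbit (u := u') (a := a) _ Xz _ sF; rewrite ?ua//=.
  by move=> g gz; apply: (xy g); apply: eqon_trans gz; exact/eqon_act/eqon_sym.
have [A [chi [[x' [y' [Gxy ax [ay nx] ny [-> ->]]]] fA]]] := task true ext_solvable F' sF' c.
exists x'; split.
- exists y'; rewrite ua /=; split=> //.
  by rewrite (fA y')// addbF.
- by move=> xz; apply: nx; exact: eqon_trans zx.
- move=> w Xw wx; apply: hF' => //.
  apply: agree_trans (eqon_agree sF' wx) _; apply: agree_trans ax _.
  exact/(eqon_agree sF')/eqon_sym.
Qed.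

(* With [v := act g x'], both values of the splitting function at [y'] occur
   while its value at [v], hence the position of the fibre over [x'], is fixed. *)
Lemma good_stage_on_orbit a u x y g : Xlev u (below a) x -> Xlev u (below a) y ->
  clusters a x y -> eqon (below a) (act g x) y ->
  exists xf, good (upd u a xf) a.
Proof.
move=> Xx Xy acc xy.
pose near F x' y' := [/\ Gam a (x', y'), agree F x' x /\ agree F y' y,
  ~ eqon (below a) (act g x') y & ~ eqon (below a) y' y].
have near_cat F F' x' y' : near (F ++ F') x' y' -> near F' x' y'.
  by move=> [Gxy [/agree_cat[_ h1] /agree_cat[_ h2]] h3 h4].
pose ext (s : bool) F : set (set (pnt W) * (pnt W -> bool)) :=
  [set Ac | exists x' y', [/\ near F x' y', Ac.1 = [set y'; act g x'] &
    if s then Ac.2 = fun=> false else exists i, [/\ in_level (below a) i,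
      crd y' i <> crd (act g x') i & Ac.2 = fun w => crd w i == crd y' i]]].
have ext_cat k F F' : ext k (F ++ F') `<=` ext k F'.
  by move=> Ac [x' [y' [/near_cat h1 h2 h3]]]; exists x', y'.
have [f [f_cont pres task]] := @stage_split u a y ext (Xlev_normal Xy) ext_cat.
have ext_solvable s : solvable_task (below a) y ext s.
  move=> F sF; have [F1 sF1 hF1] := act_cont g x sF.
  have [|x' [y' [Gxy [/agree_cat[ax ax1] /agree_cat[ay _]] nx ny nxy]]] := acc (F ++ F1) g.
    exact/supp_cat.
  have nx' : ~ eqon (below a) (act g x') y.
    by move=> h; apply: nx; apply: eqon_trans h _; exact: eqon_sym.
  have /neqonP[i Di ni] := nxy.
  exists [set y'; act g x'], (if s then fun=> false else fun w => crd w i == crd y' i); split.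
  - by exists x', y'; split=> //; case: (s) => //; exists i.
  - move=> _ [->|->] //; apply: agree_trans (hF1 _ ax1) _; exact: eqon_agree xy.
  - have /neqonP[j Dj nj] := ny; have /neqonP[k Dk nk] := nx'.
    exists [:: j; k]; first by move=> l; rewrite !inE => /orP[]/eqP ->.
    move=> _ [->|->] h; [apply: nj|apply: nk]; apply: h; rewrite !inE eqxx ?orbT//.
  - by move=> w; case: (s); [exact: loc_const_cst|exact: loc_const_crd].
exists (y, f); set u' := upd u a (y, f) in pres *.
have uu' b : below a b -> u' b = u b by move=> ba; rewrite /u' upd_lt.
have ua : u' a = (y, f) by rewrite /u' updE.
split=> //; first by rewrite ua.
move=> _; exists x; first by rewrite (Xlev_ext uu').
move=> c z Xz zx F sF.
have gz : eqon (below a) (act g z) y by apply: eqon_trans xy; exact: eqon_act.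
have [| |F' sF' hF'] := nbhs_on_orbit (u := u') (a := a) (g := g^-1%g) _ Xz _ sF;
  rewrite ?ua//=; first by rewrite invgK.
have [x' [y' [[Gxy [ax ay] nx ny] fx fy]]] : exists x' y',
    [/\ near F' x' y', f (act g x') = z.2 a (idx g^-1%g) & f y' = c].
  (* Equal values at [y'] and [act g x'] come from the constant pattern, opposite values from a
     coordinate [i] separating the two points. *)
  have [->|/eqP cz] := eqVneq c (z.2 a (idx g^-1%g)).
    have [A [chi [[x' [y' [h /= -> ->]]] fA]]] :=
      task true (ext_solvable true) F' sF' (z.2 a (idx g^-1%g)).
    by exists x', y'; split=> //; rewrite fA ?addbF//; [right|left].
  have [A [chi [[x' [y' [h /= -> [i [Di ni ->]]]]] fA]]] :=
    task false (ext_solvable false) F' sF' (z.2 a (idx g^-1%g)).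
  exists x', y'; split=> //.
    rewrite fA; last by right.
    by rewrite (introF eqP) ?addbF// => /esym.
  rewrite fA ?eqxx ?addbT; last by left.
  by case: c (z.2 _ _) cz => -[].
exists x'; split.
- by exists y'; rewrite ua.
- move=> xz; apply: nx; apply: eqon_trans (eqon_act g xz) _; exact: gz.
- move=> w Xw wx.
  have gwx : eqon (below a) (act g w) (act g x') by exact: eqon_act.
  apply: hF' => //.
    rewrite (Xlev_coord Xw) ?ua ?invgK /=; last 2 first.
    - by rewrite /upto /=.
    - by move=> gw; apply: nx; apply: eqon_trans gw; exact: eqon_sym.
    by rewrite -fx; apply: loc_const_eqon (f_cont _ nx) _; exact: eqon_sym.
  apply: agree_trans (eqon_agree sF' wx) _; apply: agree_trans ax _.
  exact/(eqon_agree sF')/eqon_sym.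
Qed.

Lemma good_data_exists : exists u, forall a, good u a.
Proof.
pose p : pnt W := (fun=> false, fun _ _ => false).
have loc a u v : (forall b, (b < a)%O -> u b = v b) ->
    forall xf, good (upd u a xf) a -> good (upd v a xf) a.
  move=> uv xf; apply: good_ext => b; rewrite /upd le_eqVlt.
  by case: eqP => //= _; exact: uv.
have ex a u : exists xf, good (upd u a xf) a.
  have [[x [y [Xx Xy acc]]]|nacc] := pselect (exists x y,
      [/\ Xlev u (below a) x, Xlev u (below a) y & clusters a x y]).
    have [[g xy]|xy] := pselect (exists g, eqon (below a) (act g x) y).
      exact: good_stage_on_orbit xy.
    by apply: good_stage_off_orbit acc _ => // g gxy; apply: xy; exists g.
  by apply: good_stage_trivial => x y Xx Xy acc; apply: nacc; exists x, y.
have [u hu] := transfinite_choice W_omega1 (p, fun=> false) loc ex.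
exists u => a; have := hu a; congr good.
by apply: funext => b; rewrite /upd; case: eqP => // ->.
Qed.

(** * Passage to the inverse limit *)

Definition lower D : Prop := forall a b, D a -> (b <= a)%O -> D b.

Lemma lower_below a : lower (below a).
Proof. by move=> b c ba cb; exact: le_lt_trans ba. Qed.

Lemma lower_upto a : lower (upto a).
Proof. by move=> b c ba cb; exact: le_trans ba. Qed.

Lemma lower_sub D a : lower D -> ~ D a -> D `<=` below a.
Proof. by move=> lD Da b Db; rewrite /below /= ltNge; apply/negP => /(lD _ _ Db). Qed.

Variable u : data.
Hypothesis u_good : forall a, good u a.

(** The coordinates outside [D] are filled in by recursion on the level, with the value [false]
    where the split point leaves them free. *)
Lemma Xlev_extend D x : lower D -> Xlev u D x ->
  exists2 z, Xlev u setT z & eqon D z x.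
Proof.
move=> lD Xx.
have f_cont a w : ~ eqon (below a) w (u a).1 -> loc_const (below a) (u a).2 w.
  by case: (u_good a) => h _ _; exact: h.
pose val_ b (tl : W -> nat -> bool) n := let w := act (e n)^-1%g (x.1, tl) in
  ~~ `[< eqon (below b) w (u b).1 >] && (u b).2 w.
pose P b tl c := c = if `[< D b >] then x.2 b else val_ b tl.
have [b tl tl' zz c|b tl|tl hz] :=
  @transfinite_choice _ _ W_omega1 (nat -> bool) (fun=> false) P.
- rewrite /P => ->; case: ifP => // _; apply: funext => n; rewrite /val_.
  have ww : eqon (below b) (act (e n)^-1%g (x.1, tl)) (act (e n)^-1%g (x.1, tl')).
    by apply/eqon_act/eqonP.
  case: asboolP => [h|h]; case: asboolP => [h'|h'] //=.
  + by case: h'; apply: eqon_trans h; exact: eqon_sym.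
  + by case: h; exact: eqon_trans h'.
  + by apply/esym; exact: loc_const_eqon (f_cont _ _ h) ww.
- by eexists.
pose z : pnt W := (x.1, tl).
have zx : eqon D z x.
  by apply/eqonP; split=> //= b Db; rewrite hz /P asboolT.
exists z => //; split.
  move=> b n; rewrite /= hz /P; case: ifP => _; first exact: (Xlev_normal Xx).
  by rewrite /val_ idxK.
move=> b _ g; rewrite /rule act_coord /= => ng.
have [Db|nDb] := pselect (D b); last by rewrite hz /P asboolF// /val_ idxK invgK asboolF.
have gzx : eqon (below b) (act g z) (act g x).
  by apply: eqon_act; apply: eqonS zx => c /ltW; exact: lD Db.
have := Xx.2 b Db g; rewrite /rule act_coord hz /P asboolT// => ->.
  by apply: loc_const_eqon (f_cont _ _ ng) gzx.
by move=> h; apply: ng; exact: eqon_trans h.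
Qed.

(** Take for [m] the largest level outside [D1] occurring in [F]. A cylinder of a limit stage thus
    belongs to an earlier stage. *)
Lemma supp_max D D1 F : lower D1 -> supp D F -> supp D1 F \/
  exists m, [/\ D m, ~ D1 m & supp (upto m) F].
Proof.
move=> lD1; elim: F => [|i F IH] sF; first by left.
have [j jF|h|[m [Dm nm h]]] := IH; first by apply: sF; rewrite inE jF orbT.
  have [hi|hi] := pselect (in_level D1 i).
    by left=> j; rewrite inE => /orP[/eqP->|/h].
  right; have := sF i (mem_head _ _); case: i {sF} hi => // -[b n] /= nb Db.
  exists b; split=> // j; rewrite inE => /orP[/eqP->|/h]; first by rewrite /= /upto /=.
  by apply: in_levelS => c /(lower_sub lD1 nb)/ltW.
right; have := sF i (mem_head _ _); case: i {sF} => [n _|[b n] /= Db].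
  by exists m; split=> // j; rewrite inE => /orP[/eqP->|/h].
have [bm|mb] := leP b m.
  by exists m; split=> // j; rewrite inE => /orP[/eqP->|/h].
exists b; split=> //; first by move=> D1b; apply: nm; apply: lD1 D1b _; exact: ltW.
move=> j; rewrite inE => /orP[/eqP->|/h]; first by rewrite /= /upto /=.
by apply: in_levelS => c cm; apply: le_trans cm _; exact: ltW.
Qed.

(** By induction on the stage: a splitting is covered by the second clause of [good], and at limits
    [supp_max] confines each cylinder to an earlier stage. *)
Lemma fibre_limit_persist D1 S D0 z : lower D1 -> Xlev u setT z ->
  (forall a, ~ D1 a -> constraints u a (D0, S)) ->
  fibre_limit u D1 S D0 z -> fibre_limit u setT S D0 z.
Proof.
move=> lD1 Xz cS lim.
have aux D : lower D -> D1 `<=` D ->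
    (forall a, D a -> ~ D1 a -> fibre_limit u (upto a) S D0 z) ->
    fibre_limit u D S D0 z.
  move=> lD D1D h F /(supp_max lD1)[sF|[m [Dm nm sF]]].
    by have [s [Ss ns hs]] := lim F sF; exists s; split=> // w /(XlevS D1D); exact: hs.
  have [s [Ss ns hs]] := h m Dm nm F sF; exists s; split=> // w Xw; apply: hs.
  by apply: XlevS Xw => c; exact: lD.
apply: (aux) => // a _; elim/(well_founded_ind (omega1_wf W_omega1)): a => a IH na.
case: (u_good a) => _ pres _; apply: pres; first exact: cS.
  by apply: XlevS Xz.
apply: aux; [exact: lower_below|exact: lower_sub|exact: IH].
Qed.

Definition Xlim : set (pnt W) := Xlev u setT.

Lemma Xlim_surj (c : nat -> bool) : exists2 z, Xlim z & z.1 = c.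
Proof.
have [|//|z Xz /eqon1 zc] := @Xlev_extend set0 (c, fun _ _ => false); last by exists z.
by [].
Qed.

(* The case of [fibre_limit] with the bottom level and the whole space: it
   expresses that the first projection is irreducible. *)
Lemma Xlim_small_fibre z F : Xlim z -> exists2 c, c <> z.1 &
  forall w, Xlim w -> w.1 = c -> agree F w z.
Proof.
move=> Xz.
have : fibre_limit u setT setT set0 z.
  apply: (@fibre_limit_persist set0) => // [a _|F' sF']; first by left.
  have [N hN] : exists N, forall n, inl n \in F' -> (n < N)%N.
    elim: F' {sF'} => [|i F' [N hN]]; first by exists 0.
    case: i => [m|bn]; last first.
      by exists N => n; rewrite inE /= => /hN.
    exists (maxn m.+1 N) => n; rewrite inE leq_max => /orP[/eqP[->]|/hN ->].
      by rewrite leqnn.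
    by rewrite orbT.
  (* Changing [z] at a base coordinate [N] beyond those in [F'] gives another point of the Cantor
     set in the same cylinder. *)
  exists ((fun n => if n == N then ~~ z.1 n else z.1 n), z.2); split=> //.
    by move=> /eqon1 /= /(congr1 (@^~ N)); rewrite eqxx; case: (z.1 N).
  move=> w _ ws i iF; have := sF' i iF; have := ws i.
  case: i iF => [n|[b n]] //= /hN nN -> //.
  by rewrite ltn_eqF.
move=> /(_ F (@suppT _ _ F))[s [_ ns hs]]; exists s.1.
  by move=> sz; apply: ns; apply/eqonP.
by move=> w Xw ws; apply: hs => //; apply/eqonP.
Qed.

Lemma Xlim_perfect z F : Xlim z -> exists2 w, Xlim w & agree F w z /\ w <> z.
Proof.
move=> Xz; have [c cz hc] := Xlim_small_fibre F Xz.
have [w Xw wc] := Xlim_surj c; exists w => //; split; first exact: hc.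
by move=> wz; apply: cz; rewrite -wc wz.
Qed.

(** The form in which diamond is used: at some stage [a] closed under [phi], [Gam a] and the pairs
    [q b] with [b < a] have the same traces on the levels below [a]. *)
Hypothesis Gam_guess : forall (q : W -> pnt W * pnt W) (phi : W -> W) a0, exists a,
  [/\ (a0 < a)%O, forall b, (b < a)%O -> (phi b < a)%O,
      forall b, (b < a)%O -> exists xy, [/\ Gam a xy,
        eqon (below a) xy.1 (q b).1 & eqon (below a) xy.2 (q b).2] &
      forall xy, Gam a xy -> exists b, [/\ (b < a)%O,
        eqon (below a) xy.1 (q b).1 & eqon (below a) xy.2 (q b).2]].

(** * Hereditary separability *)

Lemma omega1_inhabited : exists a : W, True.
Proof.
apply: contrapT => nW; case: W_omega1 => _ + _; apply.
have -> : [set: W] = set0 by apply/seteqP; split=> // a _; case: nW; exists a.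
exact: countable0.
Qed.

Lemma level_bound (i : coord W) : exists a, forall b, (a <= b)%O -> in_level (upto b) i.
Proof.
case: omega1_inhabited => a0 _; case: i => [n|[b n]]; first by exists a0.
by exists b.
Qed.

Definition matches_pattern (L : seq (coord W * bool)) x : Prop :=
  forall ib, ib \in L -> crd x ib.1 = ib.2.

Lemma countable_patterns D : countable D ->
  countable [set L : seq (coord W * bool) | forall ib, ib \in L -> in_level D ib.1].
Proof.
move=> cD; have [k hk] : exists k : nat -> coord W, range k = in_level D.
  by apply: countable_range; [exact: countable_in_level|exists (inl 0)].
apply: (@sub_countable _ _ _ (range (map (fun nb : nat * bool => (k nb.1, nb.2))))).
  apply: subset_card_le; elim=> [|[i c] L IH] hL; first by exists [::].
  have [|s _ sL] := IH; first by move=> ib ibL; apply: hL; rewrite inE ibL orbT.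
  have : in_level D i by apply: (hL (i, c)); exact: mem_head.
  rewrite -hk => -[n _ ni]; exists ((n, c) :: s) => //=.
  by rewrite sL ni.
exact/countable_image/countableP.
Qed.

Lemma supp_below_upto a b F : (b < a)%O -> supp (below a) F ->
  exists c, [/\ (c < a)%O, (b <= c)%O & supp (upto c) F].
Proof.
move=> ba; elim: F => [|i F IH] sF; first by exists b.
have [j jF|c [ca bc sc]] := IH; first by apply: sF; rewrite inE jF orbT.
have := sF i (mem_head _ _); case: i {sF} => [n _|[b' n] /= b'a].
  by exists c; split=> // j; rewrite inE => /orP[/eqP->|/sc].
exists (Order.max c b'); split; rewrite ?gt_max ?ca// ?le_max ?bc// => j.
rewrite inE => /orP[/eqP->|/sc]; first by rewrite /= /upto /= le_max lexx orbT.
by apply: in_levelS => x xc; rewrite /upto /= le_max; apply/orP; left.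
Qed.

(** Closing off: at a closure point [a], a pattern below [a] realized by some term other than [y b],
    for [b < a], is realized by a term before [a] that differs from [y b] below [a]. This is applied
    to the patterns of [y a] itself. *)
Lemma derived_of_long_sequence (y : W -> pnt W) :
  (forall a b, (a < b)%O -> y a <> y b) ->
  exists psi : W -> W, forall a, (exists b, (b < a)%O) ->
    (forall b, (b < a)%O -> (psi b < a)%O) ->
    forall F, supp (below a) F -> exists b,
      [/\ (b < a)%O, agree F (y b) (y a) & ~ eqon (below a) (y b) (y a)].
Proof.
move=> y_inj.
have /choice[wit hwit] : forall bL : W * seq (coord W * bool), exists c,
    (exists b', y b' <> y bL.1 /\ matches_pattern bL.2 (y b')) ->
    exists b', [/\ (b' < c)%O, matches_pattern bL.2 (y b') &
      ~ eqon (below c) (y b') (y bL.1)].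
  move=> [b L] /=.
  have [[b' [nb' Lb']]|h] := pselect
    (exists b', y b' <> y b /\ matches_pattern L (y b')); last by exists b.
  have /neqonP[i _ ni] : ~ eqon setT (y b') (y b) by move=> /eqonT.
  have [c0 hc0] := level_bound i.
  have [c hc] := omega1_gt W_omega1 (Order.max b' c0).
  exists c => _; exists b'; split=> //.
    by apply: le_lt_trans hc; rewrite le_max lexx.
  move=> /(_ i) h; apply/ni/h; apply: in_levelS (hc0 c0 (lexx _)) => x xc.
  by apply: le_lt_trans hc; rewrite le_max; apply/orP; right.
have /choice[psi hpsi] : forall b, exists c, forall b' L, (b' <= b)%O ->
    (forall ib, ib \in L -> in_level (upto b) ib.1) -> (wit (b', L) < c)%O.
  move=> b; have [c hc] : exists c, forall b', (wit @` (upto b `*`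
      [set L : seq (coord W * bool) |
        forall ib, ib \in L -> in_level (upto b) ib.1])) b' -> (b' < c)%O.
    apply/(countable_bounded W_omega1)/countable_image/countableX.
      exact: countable_upto.
    exact/countable_patterns/countable_upto.
  by exists c => b' L bb hL; apply: hc; exists (b', L).
exists psi => a [b0 b0a] cl F sF.
pose L := [seq (i, crd (y a) i) | i <- F].
have LP x : matches_pattern L x <-> agree F x (y a).
  split=> [h i iF|h ib /mapP[i iF ->]]; last exact: h.
  by apply: (h (i, crd (y a) i)); exact: map_f.
have near b : (b < a)%O -> exists b', [/\ (b' < a)%O, agree F (y b') (y a) &
    ~ eqon (below a) (y b') (y b)].
  move=> ba; have [c [ca bc sc]] := supp_below_upto ba sF.
  have wa : (wit (b, L) < a)%O.
    apply: lt_trans (cl _ ca); apply: hpsi => // ib /mapP[i iF ->]; exact: sc.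
  have [|b' [b'w /LP Lb' nb']] := hwit (b, L).
    by exists a; split; [move=> /esym; exact: y_inj|exact/LP].
  exists b'; split=> //; first exact: lt_trans wa.
  by move=> h; apply: nb'; apply: eqonS h => x xw; exact: lt_trans wa.
(* [y b1] may coincide with [y a] below [a]; then a second term, differing from [y b1], serves. *)
have [b1 [b1a a1 n1]] := near _ b0a.
have [b1y|nb1] := pselect (eqon (below a) (y b1) (y a)); last by exists b1.
have [b2 [b2a a2 n2]] := near _ b1a; exists b2; split=> //.
by move=> h; apply: n2; apply: eqon_trans h _; exact: eqon_sym.
Qed.

(** A failure gives a sequence of length omega_1 whose terms have cylinders missing all earlier
    terms. Where it is guessed, [y a] is a limit of guessed points; as [fibre_limit] concerns whole
    fibres, it captures the actual earlier terms, known to agree with their guesses only below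
    [a]. *)
Lemma Xlim_hereditarily_separable (Y : set (pnt W)) : Y `<=` Xlim ->
  exists Z : set (pnt W), [/\ countable Z, Z `<=` Y &
    forall y F, Y y -> exists2 x, Z x & agree F x y].
Proof.
move=> YX; apply: contrapT => nsep.
have step (Z : set (pnt W)) : countable Z -> Z `<=` Y ->
    exists yF : pnt W * seq (coord W), Y yF.1 /\ forall x, Z x -> ~ agree yF.2 x yF.1.
  move=> cZ ZY; apply: contrapT => h; apply: nsep; exists Z; split=> // y F Yy.
  by apply: contrapT => h'; apply: h; exists (y, F); split=> //= x Dx Fx; apply: h'; exists x.
(* The premise makes the choice possible for arbitrary [t]; [Yv] discharges it by induction. *)
pose P a (t : W -> pnt W * seq (coord W)) (x : pnt W * seq (coord W)) :=
  (forall b, (b < a)%O -> Y (t b).1) ->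
  Y x.1 /\ forall b, (b < a)%O -> ~ agree x.2 (t b).1 x.1.
have [a t t' vv x Px h|a t|t hv] := @transfinite_choice _ _ W_omega1 _
  ((fun=> false, fun _ _ => false), [::]) P.
- have [|Yx hx] := Px; first by move=> b ba; rewrite vv//; exact: h.
  by split=> // b ba; rewrite -vv//; exact: hx.
- have [h|h] := pselect (forall b, (b < a)%O -> Y (t b).1); last by exists (t a) => /h.
  have [||x [Yx hx]] := step ((fun b => (t b).1) @` below a).
  + by apply: countable_image; case: W_omega1 => _ _; exact.
  + by move=> _ [b /h Yb <-].
  + by exists x => _; split=> // b ba; apply: hx; exists b.
have Yv a : Y (t a).1.
  by elim/(well_founded_ind (omega1_wf W_omega1)): a => a IH; case: (hv a IH).
have nv a b : (b < a)%O -> ~ agree (t a).2 (t b).1 (t a).1.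
  by move=> ba; apply: (hv a (fun c _ => Yv c)).2.
pose y a := (t a).1.
have y_inj a b : (a < b)%O -> y a <> y b by move=> /nv h ab; apply: h; rewrite -/(y a) ab.
have [psi hpsi] := derived_of_long_sequence y_inj.
have [a0 _] := omega1_inhabited.
have [a [a0a cl Gy yG]] := Gam_guess (fun b => (y b, y b)) psi a0.
have /(_ (t a).2 (@suppT _ _ _))[s [[s' /yG[b [ba /= sb _]]] _ hs]] :
    fibre_limit u setT (Sdom a) (below a) (y a).
  apply: (@fibre_limit_persist (below a)); [exact: lower_below|exact/YX/Yv| |].
    by move=> m /negP; rewrite -leNgt => am; right; left; exists a.
  move=> F sF; have [|b [ba Fb nb]] := hpsi a _ cl F sF; first by exists a0.
  have [[s s'] [Gs /= sb _]] := Gy b ba; exists s; split; first by exists s'.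
    by move=> h; apply: nb; apply: eqon_trans h; exact: eqon_sym.
  move=> w Xw ws; apply: agree_trans Fb; apply: eqon_agree sF _.
  exact: eqon_trans sb.
by apply: (nv a b ba); apply: hs; [exact/YX/Yv|exact: eqon_sym].
Qed.

(** * Convergent sequences and homeomorphisms *)

Lemma separating_level (Q : set (pnt W)) : countable Q ->
  exists a, forall b x y, (a <= b)%O -> Q x -> Q y -> x <> y -> ~ eqon (below b) x y.
Proof.
move=> cQ.
have /choice[c hc] : forall xy : pnt W * pnt W, exists c, xy.1 <> xy.2 ->
    forall b, (c <= b)%O -> ~ eqon (below b) xy.1 xy.2.
  move=> [x y] /=; have [a0 _] := omega1_inhabited.
  have [->|ne] := pselect (x = y); first by exists a0.
  have /neqonP[i _ ni] : ~ eqon setT x y by move=> /eqonT.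
  have [c hc] := level_bound i; have [c' cc'] := omega1_gt W_omega1 c.
  exists c' => _ b cb h; apply/ni/h; apply: in_levelS (hc c (lexx _)) => t tc.
  exact: le_lt_trans tc (lt_le_trans cc' cb).
have [a ha] := countable_bounded W_omega1 (countable_image c (countableX cQ cQ)).
exists a => b x y ab Qx Qy xy; apply: (hc (x, y)) => //.
by apply: le_trans ab; apply/ltW/ha; exists (x, y).
Qed.

(** The list [r] is spread over one countable block of indices, with members of [r] as filler
    elsewhere, so that past a bound of this block the guessed stage sees exactly the listed
    pairs. *)
Lemma guess_countable (r : nat -> pnt W * pnt W) (Q : set (pnt W)) : countable Q ->
  exists a, [/\ forall x y, Q x -> Q y -> x <> y -> ~ eqon (below a) x y,
    forall n, exists xy, [/\ Gam a xy, eqon (below a) xy.1 (r n).1 &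
      eqon (below a) xy.2 (r n).2] &
    forall xy, Gam a xy -> exists n, eqon (below a) xy.1 (r n).1 /\
      eqon (below a) xy.2 (r n).2].
Proof.
move=> /separating_level[a1 ha1].
have [a0 _] := omega1_inhabited.
have [k kI] := disjoint_countable_blocks W_omega1.
pose q b := if pselect (exists n, k a0 n = b) is left h then r (projT1 (cid h)) else r 0.
have qk n : q (k a0 n) = r n.
  rewrite /q; case: pselect => [h|[]]; last by exists n.
  by case: cid => m /= /kI[_ ->].
have qr b : exists n, q b = r n.
  by rewrite /q; case: pselect => [h|_]; [exists (projT1 (cid h))|exists 0].
have [a2 ha2] := countable_bounded W_omega1 (countable_image (k a0) (countableP [set: nat])).
have [a [aa _ Gq qG]] := Gam_guess q id (Order.max a1 a2).
have {aa} [a1a a2a] : (a1 < a)%O /\ (a2 < a)%O by apply/andP; rewrite -gt_max.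
exists a; split=> [x y|n|xy /qG[b [_]]]; first by apply: ha1; exact: ltW.
  have [|xy] := Gq (k a0 n); first by apply: lt_trans a2a; apply: ha2; exists n.
  by rewrite qk => h; exists xy.
by have [n ->] := qr b; exists n.
Qed.

(** This carries the third clause of [good] to the limit: arbitrarily near [z] lie fibres over first
    members of pairs whose second members have the colour [c], read off as the coordinate [idx 1] at
    [a]. *)
Lemma Xlim_split_limit a x0 y0 : Xlim x0 -> Xlim y0 -> clusters a x0 y0 ->
  exists2 z, Xlim z & forall c F, exists x y,
    [/\ Gam a (x, y), ~ eqon (below a) x z,
        forall w, Xlim w -> eqon (below a) w x -> agree F w z &
        forall w, Xlim w -> eqon (below a) w y -> w.2 a (idx 1%g) = c].
Proof.
move=> Xx0 Xy0 acc; case: (u_good a) => f_cont _ [|x Xx hx].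
  by exists x0, y0; split=> //; [apply: XlevS Xx0|apply: XlevS Xy0].
have [z Xz zx] := Xlev_extend (@lower_below a) Xx.
exists z => // c F.
have /(_ F (@suppT _ _ _))[s [[y [Gsy ny fy]] ns hs]] :
    fibre_limit u setT (Scol u a c) (below a) z.
  apply: (@fibre_limit_persist (upto a)) => //; first exact: lower_upto.
    move=> b /negP; rewrite -ltNge => ab; right; right.
    by exists (a, c).
  by apply: hx => //; apply: XlevS Xz.
exists s, y; split=> // w Xw wy.
have nw : ~ eqon (below a) w (u a).1.
  by move=> h; apply: ny; apply: eqon_trans h; exact: eqon_sym.
have := Xlev_coord Xw (a := a) (g := 1%g) I.
rewrite invg1 act1; last exact: Xlev_normal Xw.
move=> -> //; rewrite -fy; apply: loc_const_eqon (f_cont _ ny) _.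
exact: eqon_sym.
Qed.

Definition pt_cvg (s : nat -> pnt W) x : Prop :=
  forall F, exists N, forall n, (N <= n)%N -> agree F (s n) x.

Lemma neq_coord x y : x <> y -> exists i, crd x i <> crd y i.
Proof.
move=> xy; have /neqonP[i _ ni] : ~ eqon setT x y by move=> /eqonT.
by exists i.
Qed.

(** The guessed pairs are [(s m, s n)] with [m < n], and they cluster at [(x, x)]. Near the
    resulting [z], some [s m] with [m] large has a partner [s n] whose coordinate [idx 1] at [a]
    differs from that of [x], against convergence. *)
Lemma Xlim_no_convergent_sequence (s : nat -> pnt W) x :
  (forall n, Xlim (s n)) -> Xlim x -> pt_cvg s x ->
  exists N, forall n, (N <= n)%N -> s n = x.
Proof.
move=> Xs Xx sx; apply: contrapT => nconst.
have often N : exists2 n, (N <= n)%N & s n <> x.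
  apply: contrapT => h; apply: nconst; exists N => n Nn.
  by apply: contrapT => nsx; apply: h; exists n.
pose pairs := [set mn : nat * nat | [/\ (mn.1 < mn.2)%N, s mn.1 <> x & s mn.2 <> x]].
have [r hr] : exists r : nat -> nat * nat, range r = pairs.
  apply: countable_range; first exact: countableP.
  have [m _ nm] := often 0; have [n mn nn] := often m.+1.
  by exists (m, n).
pose Q := [set x] `|` (fun kn => act (e kn.1) (s kn.2)) @` [set: nat * nat].
have cQ : countable Q.
  apply: countable_setU; first exact: countable1.
  exact/countable_image/countableP.
have Qx : Q x by left.
have Qs g n : Q (act g (s n)) by right; exists (idx g, n); rewrite //= idxK.
have Qs1 n : Q (s n) by rewrite -(act1 (Xlev_normal (Xs n))).
have [a [Qa Gr rG]] := guess_countable (fun n => (s (r n).1, s (r n).2)) cQ.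
have acc : clusters a x x.
  move=> F g sF; have [N hN] := sx F.
  have [m Nm nm] := often N.
  (* Either [act g (s m)] is [x], from which [s n] differs, or it is another point, which the
     sequence eventually avoids. *)
  have [M hM] : exists M, forall n, (M <= n)%N -> s n <> x -> s n <> act g (s m).
    have [gx|gx] := pselect (act g (s m) = x); first by exists 0 => n _; rewrite gx.
    have [i ni] := neq_coord gx; have [M hM] := sx [:: i].
    by exists M => n /hM/agree1 h _ e_; apply: ni; rewrite -e_.
  have [n Mn nn] := often (maxn M (maxn N m.+1)).
  move: Mn; rewrite !geq_max => /and3P[Mn Nn mn].
  have [j _ rj] : range r (m, n) by rewrite hr.
  have [[x' y'] [Gxy /=]] := Gr j; rewrite rj /= => xm yn.
  exists x', y'; split=> //.
  - by split; apply: agree_trans (eqon_agree sF _) _; eauto.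
  - move=> h; apply: (Qa (s m) x) => //.
    apply: (@eqon_actV _ g); [exact: Xlev_normal (Xs m)|exact: Xlev_normal Xx|].
    by apply: eqon_trans h; apply/eqon_act/eqon_sym.
  - by move=> h; apply: (Qa (s n) x) => //; apply: eqon_trans h; exact: eqon_sym.
  - move=> h; apply: (Qa (s n) (act g (s m))) => //; first exact: hM.
    apply: eqon_trans (eqon_act g xm); apply: eqon_trans h; exact: eqon_sym.
have [z Xz hz] := Xlim_split_limit Xx Xx acc.
have [N hN] := sx [:: inr (a, idx 1%g)].
(* [F] keeps the finitely many early terms away from [z]. *)
have [F hF] : exists F, forall n, (n < N)%N -> ~ eqon (below a) (s n) z -> ~ agree F (s n) z.
  elim: (N) => [|k [F hF]]; first by exists [::].
  have [kz|/neqonP[i _ ni]] := pselect (eqon (below a) (s k) z).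
    by exists F => n; rewrite ltnS leq_eqVlt => /orP[/eqP->|/hF].
  exists (i :: F) => n; rewrite ltnS leq_eqVlt => /orP[/eqP-> _ h|nk nz h].
    by apply: ni; apply: h; exact: mem_head.
  by apply: (hF n nk nz) => j jF; apply: h; rewrite inE jF orbT.
have [x' [y' [Gxy nx' hx' hy']]] := hz (~~ x.2 a (idx 1%g)) F.
have [j [/= xj yj]] := rG _ Gxy.
have [/= mn _ _] : pairs (r j) by rewrite -hr; exists j.
have Nm : (N <= (r j).1)%N.
  rewrite leqNgt; apply/negP => mN; apply: (hF _ mN).
    by move=> h; apply: nx'; exact: eqon_trans h.
  by apply: hx' => //; exact: eqon_sym.
have := hN (r j).2 (leq_trans Nm (ltnW mn)) => /agree1 /=.
rewrite (hy' (s (r j).2))//; last exact: eqon_sym.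
by case: (x.2 _ _).
Qed.

(** The guessed pairs are [(s n, h (s n))] for a dense sequence [s]. If [h] agrees with no [act g]
    near [x], they cluster at [(x, h x)]; at the resulting [z], pairs coloured unlike [h z] violate
    continuity. *)
Lemma Xlim_hom_locally_act (h : pnt W -> pnt W) :
  (forall x, Xlim x -> Xlim (h x)) ->
  (forall x y, Xlim x -> Xlim y -> h x = h y -> x = y) ->
  (forall x F, Xlim x -> exists F', forall y, Xlim y -> agree F' y x ->
     agree F (h y) (h x)) ->
  forall x, Xlim x -> exists F g, forall y, Xlim y -> agree F y x -> h y = act g y.
Proof.
move=> hX h_inj h_cont x Xx; apply: contrapT => nloc.
have [D [cD DX Ddense]] := Xlim_hereditarily_separable (@subset_refl _ Xlim).
have [s hs] : exists s : nat -> pnt W, range s = D.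
  by apply: countable_range => //; have [y Dy _] := Ddense x [::] Xx; exists y.
have Xs n : Xlim (s n) by apply: DX; rewrite -hs; exists n.
have neq_open g z : Xlim z -> h z <> act g z -> exists F, forall y, Xlim y ->
    agree F y z -> h y <> act g y.
  move=> Xz /neq_coord[i ni]; have [F1 h1] := h_cont z [:: i] Xz.
  have [F2 _ h2] := act_cont g z (@suppT _ _ [:: i]).
  exists (F1 ++ F2) => y Xy /agree_cat[/(h1 y Xy)/agree1 a1 /h2/agree1 a2] hy.
  by apply: ni; rewrite -a1 -a2 hy.
have dense F g : exists n, [/\ agree F (s n) x, h (s n) <> act g (s n) & s n <> x].
  have [z [Xz Fz nz zx]] : exists z, [/\ Xlim z, agree F z x, h z <> act g z & z <> x].
    have [z [Xz Fz nz]] : exists z, [/\ Xlim z, agree F z x & h z <> act g z].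
      apply: contrapT => hn; apply: nloc; exists F, g => y Xy Fy.
      by apply: contrapT => ny; apply: hn; exists y.
    (* Disagreement with [act g] is an open condition and no point is isolated, so it also occurs at
       a point other than [x]. *)
    have [zx|zx] := pselect (z = x); last by exists z.
    subst z; have [F' hF'] := neq_open g x Xx nz.
    have [w Xw [/agree_cat[Fw F'w] wx]] := Xlim_perfect (F ++ F') Xx.
    by exists w; split=> //; exact: hF'.
  have [F' hF'] := neq_open g z Xz nz.
  have [i ni] := neq_coord zx.
  have [t Dt hn] := Ddense z (i :: F ++ F') Xz.
  have [n _ nt] : range s t by rewrite hs.
  subst t.
  have /agree_cat[Fn F'n] : agree (F ++ F') (s n) z.
    by move=> j jF; apply: hn; rewrite inE jF orbT.
  exists n; split; [exact: agree_trans Fz|exact: hF'|].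
  by move=> snx; apply: ni; rewrite -snx (hn i) ?mem_head.
pose Q := [set x; h x] `|` (h @` range s `|`
  (fun kn => act (e kn.1) (s kn.2)) @` [set: nat * nat]).
have cQ : countable Q.
  apply: countable_setU; first by apply: countable_setU; exact: countable1.
  apply: countable_setU; apply: countable_image; last exact: countableP.
  exact/countable_image/countableP.
have Qx : Q x by left; left.
have Qhx : Q (h x) by left; right.
have Qh n : Q (h (s n)) by right; left; exists (s n) => //; exists n.
have Qs g n : Q (act g (s n)) by right; right; exists (idx g, n); rewrite //= idxK.
have Qs1 n : Q (s n) by rewrite -(act1 (Xlev_normal (Xs n))).
have [a [Qa Gr rG]] := guess_countable (fun n => (s n, h (s n))) cQ.
have acc : clusters a x (h x).
  move=> F g sF; have [F' hF'] := h_cont x F Xx.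
  have [n [/agree_cat[Fn F'n] ng nx]] := dense (F ++ F') g.
  have [[x' y'] [Gxy /= xn yn]] := Gr n.
  exists x', y'; split=> //.
  - split; first exact: agree_trans (eqon_agree sF xn) _.
    by apply: agree_trans (eqon_agree sF yn) _; exact: hF'.
  - move=> hh; apply: (Qa (s n) x) => //.
    apply: (@eqon_actV _ g); [exact: Xlev_normal (Xs n)|exact: Xlev_normal Xx|].
    by apply: eqon_trans hh; apply/eqon_act/eqon_sym.
  - move=> hh; apply: (Qa (h (s n)) (h x)) => //.
      by move=> /h_inj sx; apply: nx; exact: sx.
    by apply: eqon_trans hh; exact: eqon_sym.
  - move=> hh; apply: (Qa (h (s n)) (act g (s n))) => //.
    by apply: eqon_trans (eqon_act g xn); apply: eqon_trans hh; exact: eqon_sym.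
have [z Xz hz] := Xlim_split_limit Xx (hX x Xx) acc.
have [F hF] := h_cont z [:: inr (a, idx 1%g)] Xz.
have [x' [y' [Gxy _ hx' hy']]] := hz (~~ (h z).2 a (idx 1%g)) F.
have [n [/= xn yn]] := rG _ Gxy.
have /(hF _ (Xs n))/agree1 /= : agree F (s n) z by apply: hx' => //; exact: eqon_sym.
rewrite (hy' (h (s n))); [by case: ((h z).2 _ _)|exact/hX/Xs|exact: eqon_sym].
Qed.

(** * The subspace X and its properties *)

Definition Xspace : set (pspace W) := Xlim.

Definition toX x (Xx : Xlim x) : Xspace := exist _ (x : pspace W) (mem_set Xx).

Lemma Xspace_val (x : Xspace) : Xlim (set_val x).
Proof. exact: set_valP. Qed.

Definition actX g (x : Xspace) : Xspace := toX (Xlev_act g (Xspace_val x)).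

Definition projX (x : Xspace) : cantor_space := fst (set_val x).

Lemma Xspace_continuousP (f : Xspace -> Xspace) : continuous f <->
  forall (x : Xspace) F, exists F', forall y : Xspace,
    agree F' (set_val y : pnt W) (set_val x) ->
    agree F (set_val (f y) : pnt W) (set_val (f x)).
Proof.
split=> [cf x F|h x U /nbhs_subset_type[F hF]].
  have := cf x [set y : Xspace | agree F (set_val y : pnt W) (set_val (f x))].
  move=> cfF; have : nbhs (f x) [set y : Xspace | agree F (set_val y : pnt W) (set_val (f x))].
    by apply/nbhs_subset_type; exists F.
  by move=> /cfF/nbhs_subset_type.
have [F' hF'] := h x F; apply/nbhs_subset_type; exists F' => y /hF'.
exact: hF.
Qed.

Lemma actX_action : continuous_action actX.
Proof.
split=> [x|g h x|g].
- by apply: val_inj; rewrite /= act1//; exact: Xlev_normal (Xspace_val x).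
- by apply: val_inj; exact: actM.
exists (actX g^-1%g); split.
- by move=> x; apply: val_inj; rewrite /= actKV//; exact: Xlev_normal (Xspace_val x).
- by move=> x; apply: val_inj; rewrite /= actVK//; exact: Xlev_normal (Xspace_val x).
- apply/Xspace_continuousP => x F.
  by have [F' _ hF'] := act_cont g (set_val x) (@suppT _ _ F); exists F' => y /hF'.
- apply/Xspace_continuousP => x F.
  by have [F' _ hF'] := act_cont g^-1%g (set_val x) (@suppT _ _ F); exists F' => y /hF'.
Qed.

Lemma closed_pspaceP (A : set (pspace W)) : (forall x : pnt W,
  (forall F, exists y : pnt W, A y /\ agree F y x) -> A x) -> closed A.
Proof.
move=> h x clx; apply: h => F.
have [|y [Ay Fy]] := clx [set y : pspace W | agree F (y : pnt W) x].
  by apply/nbhs_pspace; exists F.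
by exists y.
Qed.

Lemma Xspace_closed : closed Xspace.
Proof.
apply: closed_pspaceP => x hx; split.
  move=> a n; have [y [[ny _] hy]] := hx [:: inr (a, n); inr (a, idx (e n))].
  have /= <- := hy (inr (a, n)); last exact: mem_head.
  have /= <- := hy (inr (a, idx (e n))); last by rewrite !inE eqxx orbT.
  exact: ny.
(* The rule is a closed condition: the coordinate [i] keeps nearby points off the split point, where
   the splitting function is locally constant. *)
move=> b _ g; rewrite /rule => ng; have /neqonP[i Di ni] := ng.
have [f_cont _ _] := u_good b.
have [F1 _ h1] := f_cont _ ng.
have [F' _ h'] := act_cont g x (@suppT _ _ (i :: inr (b, idx 1%g) :: F1)).
have [y [[_ Ry] /h' hy]] := hx F'.
have hyb : (act g y).2 b (idx 1%g) = (act g x).2 b (idx 1%g).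
  by apply: (hy (inr (b, idx 1%g))); rewrite !inE eqxx orbT.
rewrite -hyb (Ry b I g).
  by apply: h1 => j jF; apply: hy; rewrite !inE jF !orbT.
by move=> /(_ i Di); rewrite hy ?mem_head.
Qed.

Lemma Xspace_compact : compact Xspace.
Proof. exact: subclosed_compact Xspace_closed (@pspace_compact d W) _. Qed.

Lemma Xspace_no_isolated : isolated Xspace = set0.
Proof.
apply/seteqP; split=> // x [/set_mem Xx [V /nbhs_pspace[F hF] VX]].
have [w Xw [Fw wx]] := Xlim_perfect F Xx.
have : (V `&` Xspace) w by split=> //; exact: hF.
by rewrite VX => /wx.
Qed.

Lemma projX_surj : range projX = [set: cantor_space].
Proof.
apply/seteqP; split=> // c _; have [z Xz zc] := Xlim_surj c.
by exists (toX Xz).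
Qed.

Lemma Xspace_hereditarily_separable : hereditarily_separable Xspace.
Proof.
move=> Y.
have [|D [cD DY hD]] := @Xlim_hereditarily_separable (set_val @` Y).
  by move=> _ [y _ <-]; exact: Xspace_val.
exists [set y : Y | D (set_val (set_val y))].
  have /countable_injP[k kI] := cD.
  apply/countable_injP; exists (fun y : Y => k (set_val (set_val y))) => y y'.
  by rewrite !inE => Dy Dy' /kI; rewrite !inE => /(_ Dy Dy')/val_inj/val_inj.
move=> O [y Oy] [V oV VO].
have : nbhs (set_val y) V by apply: open_nbhs_nbhs; split=> //; rewrite -VO in Oy.
move=> /nbhs_subset_type[F hF].
have [|x Dx Fx] := hD (set_val (set_val y)) F.
  by exists (set_val y) => //; exact: set_valP.
have [t Yt tx] := DY x Dx; subst x.
exists (exist _ t (mem_set Yt)); split=> //.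
by rewrite -VO; exact: hF.
Qed.

Lemma Xspace_no_convergent : no_nontrivial_convergent_sequences Xspace.
Proof.
move=> s [l sl]; exists l.
have [||F|N hN] := @Xlim_no_convergent_sequence (fun n => set_val (s n)) (set_val l).
- by move=> n; exact: Xspace_val.
- exact: Xspace_val.
- have /sl[N _ hN] : nbhs l [set y : Xspace | agree F (set_val y : pnt W) (set_val l)].
    by apply/nbhs_subset_type; exists F.
  by exists N => n /hN.
by exists N => // n /hN h; apply: val_inj.
Qed.

Lemma actX_free : free_action actX.
Proof.
move=> g g1 x gx; apply: g1; apply: (@rho_free g (set_val x).1).
by rewrite -{2}gx.
Qed.

Lemma Hom_Xspace_locally_act : @Hom Xspace `<=` Hloc actX.
Proof.
move=> f fH; split=> //; have [f' [fK _ /Xspace_continuousP f_cont _]] := fH.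
pose h (x : pnt W) : pnt W := if pselect (Xlim x) is left Xx then set_val (f (toX Xx)) else x.
have hE (x : Xspace) : h (set_val x) = set_val (f x).
  rewrite /h; case: pselect => [Xx|[]]; last exact: Xspace_val.
  by congr (set_val (f _)); exact: val_inj.
have hX x : Xlim x -> Xlim (h x).
  by move=> Xx; rewrite (hE (toX Xx)); exact: Xspace_val.
have h_inj x y : Xlim x -> Xlim y -> h x = h y -> x = y.
  move=> Xx Xy; rewrite (hE (toX Xx)) (hE (toX Xy)) => /val_inj/(can_inj fK).
  by move=> /(congr1 set_val).
have h_cont x F : Xlim x -> exists F', forall y, Xlim y -> agree F' y x ->
    agree F (h y) (h x).
  move=> Xx; have [F' hF'] := f_cont (toX Xx) F; exists F' => y Xy Fy.
  by rewrite (hE (toX Xx)) (hE (toX Xy)); exact: hF'.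
move=> x; have [F [g hF]] := Xlim_hom_locally_act hX h_inj h_cont (Xspace_val x).
exists [set y : Xspace | agree F (set_val y : pnt W) (set_val x)], g; split=> //.
  rewrite openE => y Fy; apply/nbhs_subset_type; exists F => t Ft.
  exact: agree_trans Ft Fy.
by move=> y Fy; apply: val_inj; rewrite -[LHS]hE hF//; exact: Xspace_val.
Qed.

Lemma cantor_cylinder_clopen (s : seq nat) (c : cantor_space) :
  clopen [set x : cantor_space | forall k, k \in s -> x k = c k].
Proof.
split.
  rewrite openE => x xc; apply/nbhs_cantor; exists s => y yx k ks.
  by rewrite yx// xc.
move=> x clx k ks.
have [|y [yc yx]] := clx [set y : cantor_space | forall k, k \in s -> y k = x k].
  by apply/nbhs_cantor; exists s.
by rewrite -yx// yc.
Qed.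

(** A basic open set contains a whole fibre, over some [c], by [Xlim_small_fibre]. By compactness
    the image of its complement is closed, and it misses [c]; so the preimage of some clopen
    cylinder around [c] lies inside. *)
Lemma Xspace_pi_base : pi_base [set projX @^-1` K | K in
  [set K : set cantor_space | clopen K /\ K !=set0]].
Proof.
have cfst : continuous (fst : pspace W -> cantor_space).
  by move=> p; exact: (@cvg_fst _ _ (nbhs p.1) (nbhs p.2)).
split=> [_ [K [[oK _] [c Kc]] <-]|O oO [z Oz]].
  split; last first.
    have [x _ xc] : range projX c by rewrite projX_surj.
    by exists x; rewrite /= xc.
  exists (fst @^-1` K) => //.
  by move/continuousP: cfst; exact.
have /nbhs_subset_type[F hF] : nbhs z O by exact: open_nbhs_nbhs.
have [c cz hc] := Xlim_small_fibre F (Xspace_val z).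
pose A := Xspace `&` [set y : pspace W | ~ agree F (y : pnt W) (set_val z)].
have Acl : closed A.
  apply: closedI; first exact: Xspace_closed.
  apply: closed_pspaceP => x hx Fx; have [y [/= ny Fy]] := hx F.
  by apply: ny; exact: agree_trans Fx.
have Aco : compact A by apply: subclosed_compact Acl (@pspace_compact d W) _.
have cA : closed (fst @` A).
  apply: compact_closed; first exact: cantor_space_hausdorff.
  by apply: continuous_compact => //; exact: continuous_subspaceT.
have /nbhs_cantor[s hs] : nbhs (c : cantor_space) (~` (fst @` A)).
  apply: open_nbhs_nbhs; split; first exact: closed_openC.
  by move=> [x [Xx nFx] xc]; apply: nFx; exact: hc.
exists (projX @^-1` [set x : cantor_space | forall k, k \in s -> x k = c k]).
  exists [set x : cantor_space | forall k, k \in s -> x k = c k] => //.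
  by split; [exact: cantor_cylinder_clopen|exists c].
move=> x /hs nx; apply: hF; apply: contrapT => nF; apply: nx.
by exists (set_val x) => //; split=> //; exact: Xspace_val.
Qed.

End Action.

(** * The group structure on G0 *)

Section HomeoGroup.
Variables (T : topologicalType) (G0 : set (T -> T)).

(** The proof that [G0] is a group is a parameter of the type, so that the group instance can be
    attached to it. *)
Definition homeo_sub (_ : homeo_group G0) : Type := {g : T -> T | G0 g}.

Hypothesis G0_group : homeo_group G0.
Local Notation G := (homeo_sub G0_group).

Lemma homeo_id : G0 idfun. Proof. by have [_ h _ _] := G0_group. Qed.

Lemma homeo_comp f g : G0 f -> G0 g -> G0 (f \o g).
Proof. by have [_ _ h _] := G0_group; exact: h. Qed.

Definition homeo_one : G := exist _ idfun homeo_id.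

Definition homeo_mul (g h : G) : G :=
  exist _ (sval g \o sval h) (homeo_comp (svalP g) (svalP h)).

Lemma homeo_inv_ex (g : G) : exists h : G,
  cancel (sval g) (sval h) /\ cancel (sval h) (sval g).
Proof.
have [_ _ _ hV] := G0_group; have [h [Gh gh hg]] := hV _ (svalP g).
by exists (exist _ h Gh).
Qed.

Definition homeo_inv (g : G) : G := projT1 (cid (homeo_inv_ex g)).

Lemma homeo_sub_inj (g h : G) : (forall x, sval g x = sval h x) -> g = h.
Proof.
move=> gh; apply: eq_sig_hprop; last exact: funext.
by move=> ? ? ?; exact: Prop_irrelevance.
Qed.

Lemma homeo_oneE x : sval homeo_one x = x.
Proof. by []. Qed.

Lemma homeo_mulE g h x : sval (homeo_mul g h) x = sval g (sval h x).
Proof. by []. Qed.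

Lemma homeo_mulA : associative homeo_mul.
Proof. by move=> g h k; apply: homeo_sub_inj => x; rewrite !homeo_mulE. Qed.

Lemma homeo_mul1 : left_id homeo_one homeo_mul.
Proof. by move=> g; apply: homeo_sub_inj => x; rewrite homeo_mulE homeo_oneE. Qed.

Lemma homeo_1mul : right_id homeo_one homeo_mul.
Proof. by move=> g; apply: homeo_sub_inj => x; rewrite homeo_mulE homeo_oneE. Qed.

Lemma homeo_mulV : left_inverse homeo_one homeo_inv homeo_mul.
Proof.
move=> g; apply: homeo_sub_inj => x; rewrite homeo_mulE homeo_oneE /homeo_inv.
by case: cid => h /= [].
Qed.

Lemma homeo_Vmul : right_inverse homeo_one homeo_inv homeo_mul.
Proof.
move=> g; apply: homeo_sub_inj => x; rewrite homeo_mulE homeo_oneE /homeo_inv.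
by case: cid => h /= [].
Qed.

HB.instance Definition _ := gen_eqMixin G.
HB.instance Definition _ := gen_choiceMixin G.
HB.instance Definition _ := isGroup.Build G
  homeo_mulA homeo_mul1 homeo_1mul homeo_mulV homeo_Vmul.

Definition homeo_in (f : T -> T) : G :=
  if pselect (G0 f) is left h then exist _ f h else homeo_one.

Lemma homeo_inE f : G0 f -> sval (homeo_in f) = f.
Proof. by move=> Gf; rewrite /homeo_in; case: pselect. Qed.

Lemma homeo_in_embedding : subgroup_embedding G0 (homeo_in : _ -> G).
Proof.
split=> [g h Gg Gh gh|g h Gg Gh]; first by rewrite -(homeo_inE Gg) gh homeo_inE.
apply: homeo_sub_inj => x; rewrite [RHS]homeo_mulE !homeo_inE//.
exact: homeo_comp.
Qed.

End HomeoGroup.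

(** * Assembly of the construction *)

Theorem mainTheorem4 (d : Order.disp_t) (W : orderType d)
    (W_omega1 : is_omega1 W) (W_diamond : diamond W)
    (G0 : set (cantor_space -> cantor_space))
    (G0_group : homeo_group G0) (G0_countable : countable G0)
    (G0_free : acts_freely G0) :
  exists (X : set (cantor_space * prod_topology (fun _ : W => cantor_space)))
         (G : groupType)
         (iota : (cantor_space -> cantor_space) -> G)
         (act : G -> X -> X),
    let proj (x : X) : cantor_space := fst (set_val x) in
    [/\ subgroup_embedding G0 iota /\ continuous_action act,
        [/\ compact X, isolated X = set0 & range proj = [set: cantor_space]],
        hereditarily_separable X /\ no_nontrivial_convergent_sequences X,
        free_action act /\
          (forall (x : X) (g : cantor_space -> cantor_space), G0 g ->
             g (proj x) = proj (act (iota g) x)) &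
        @Hom X `<=` Hloc act /\
          pi_base [set proj @^-1` K | K in
                     [set K : set cantor_space | clopen K /\ K !=set0]]].
Proof.
pose G : groupType := homeo_sub G0_group.
pose rho (g : G) (x : nat -> bool) : nat -> bool := sval g x.
have rho1 x : rho 1%g x = x by [].
have rhoM g h x : rho (g * h)%g x = rho g (rho h x) by [].
have rho_cont g x n : exists s : seq nat,
    forall y, (forall k, k \in s -> y k = x k) -> rho g y n = rho g x n.
  have [g' [_ _ cg _]] : Hom (sval g) by have [h _ _ _] := G0_group; exact/h/svalP.
  have /nbhs_cantor[s hs] : nbhs (x : cantor_space)
      [set y : cantor_space | (sval g y) n = (sval g x) n].
    apply: (cg x [set z : cantor_space | z n = sval g x n]).
    by apply/nbhs_cantor; exists [:: n] => z; apply; exact: mem_head.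
  by exists s => y /hs.
have rho_free g x : rho g x = x -> g = 1%g.
  move=> gx; apply: contrapT => g1; have gid : sval g <> idfun.
    by move=> gid; apply: g1; apply: homeo_sub_inj => y; rewrite gid.
  by have := G0_free _ (svalP g) gid x; apply.
have [e0 he0] : exists e0 : nat -> cantor_space -> cantor_space, range e0 = G0.
  by apply: countable_range => //; exists idfun; have [] := G0_group.
have /choice[e he] : forall n, exists g : G, sval g = e0 n.
  move=> n; have Ge : G0 (e0 n) by rewrite -he0; exists n.
  by exists (exist _ _ Ge).
have /choice[idx idxK] : forall g : G, exists n, e n = g.
  move=> g; have [n _ en] : range e0 (sval g) by rewrite he0; exact: svalP.
  by exists n; apply: homeo_sub_inj => x; rewrite he en.
have [qh hqh] := diamond_sequences W_omega1 W_diamond.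
(* [diamond_sequences] controls the guesses only at indices below [a]. *)
pose Gam a : set (pnt W * pnt W) := [set xy | exists b, (b < a)%O /\ qh a b = xy].
have [u u_good] := good_data_exists rho1 rhoM rho_cont rho_free idxK W_omega1 Gam.
have Gam_guess (q : W -> pnt W * pnt W) (phi : W -> W) a0 : exists a,
  [/\ (a0 < a)%O, forall b, (b < a)%O -> (phi b < a)%O,
      forall b, (b < a)%O -> exists xy, [/\ Gam a xy,
        eqon (below a) xy.1 (q b).1 & eqon (below a) xy.2 (q b).2] &
      forall xy, Gam a xy -> exists b, [/\ (b < a)%O,
        eqon (below a) xy.1 (q b).1 & eqon (below a) xy.2 (q b).2]].
  have [a [a0a cl hq]] := hqh q phi a0; exists a; split=> // [b ba|xy [b [ba qb]]].
    by have [h1 h2] := hq b ba; exists (qh a b); split=> //; exists b.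
  by rewrite -qb; have [h1 h2] := hq b ba; exists b.
exists (Xspace rho e idx u), G, (homeo_in G0_group), (@actX _ W G rho e idx rhoM idxK u).
split.
- by split; [exact: homeo_in_embedding|exact: actX_action].
- split.
  + exact: Xspace_compact u_good.
  + exact: Xspace_no_isolated u_good.
  + exact: projX_surj u_good.
- split.
  + exact: Xspace_hereditarily_separable u_good Gam_guess.
  + exact: Xspace_no_convergent u_good Gam_guess.
- split; first exact: actX_free.
  by move=> x g Gg; rewrite /= /rho homeo_inE.
- split; first exact: Hom_Xspace_locally_act u_good Gam_guess.
  exact: Xspace_pi_base u_good.
Qed.
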